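(* Let $x_0\in\mathbb{R}^d$ have support $T$ with $|T|=s$, let $\mathcal{S}=(S_i)_{i=1}^k$ be a partition of $\{1,\dots,d\}$ with $S_i\cap T\neq\emptyset$ for every $i$, and put $\rho_i=|S_i|/d$, $\alpha_i=|T\cap S_i|/|S_i|$, $\bar\alpha=\min_i\alpha_i$. Let $\omega_1,\dots,\omega_k\ge0$ and $w=\sum_{i=1}^k\omega_i1_{S_i}$. Then the statistical dimension of the descent cone $\mathcal{D}(\|\cdot\|_{1,w},x_0)$ satisfies $$\tilde m_{\mathcal{S},T,w}-\frac{2}{d}\sqrt{\frac{1}{\bar\alpha}}\ \le\ \frac{\delta\big(\mathcal{D}(\|\cdot\|_{1,w},x_0)\big)}{d}\ \le\ \tilde m_{\mathcal{S},T,w}.$$ Moreover, the following bound independent of $\alpha$ holds: $$\tilde m_{\mathcal{S},T,w}-\frac{2}{\sqrt d}\ \le\ \frac{\delta\big(\mathcal{D}(\|\cdot\|_{1,w},x_0)\big)}{d}\ \le\ \tilde m_{\mathcal{S},T,w}.$$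
   Context: $1_{S_i}\in\mathbb{R}^d$ is the indicator vector of $S_i$ and $\|x\|_{1,w}=\sum_{j=1}^d w_j|x(j)|$. The descent cone of a convex function $f$ at $x_0$ is $\mathcal{D}(f,x_0)=\{v\in\mathbb{R}^d:\ \exists\,\tau>0,\ f(x_0+\tau v)\le f(x_0)\}$. The statistical dimension of a closed convex cone $C\subseteq\mathbb{R}^d$ is $\delta(C)=\mathbb{E}\big(\|\Pi_C g\|_2^2\big)$, where $g$ is a standard Gaussian vector in $\mathbb{R}^d$ and $\Pi_C$ is the metric projection onto $C$; the statistical dimension of a general convex cone is that of its closure. With $\sigma=s/d$ and, for $t\ge0$, $\varphi(t)=\sqrt{2/\pi}\int_t^\infty(x-t)^2e^{-x^2/2}\,dx$, define $$\tilde m_{\mathcal{S},T,w}=\inf_{\tau>0}\Big(\sigma+\sum_{i=1}^k\rho_i\big(\alpha_i(\omega_i\tau)^2+(1-\alpha_i)\varphi(\omega_i\tau)\big)\Big).$$ *)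

(* Defs.v *)
From HB Require Import structures.
From mathcomp Require Import all_boot all_order all_algebra.
From mathcomp Require Import all_classical all_reals all_analysis.

Set Implicit Arguments.
Unset Strict Implicit.
Unset Printing Implicit Defensive.

Import Order.TTheory GRing.Theory Num.Theory.
Import numFieldNormedType.Exports.

Local Open Scope classical_set_scope.
Local Open Scope ring_scope.

(** The library norm on ['rV[R]_d] is the sup norm (it induces the usual
    topology), so the Euclidean norm is defined here. *)

Section Vectors.
Context {R : realType} {d : nat}.
Implicit Types (x v w : 'rV[R]_d) (C : set 'rV[R]_d).

Definition norm2 x : R := Num.sqrt (\sum_j x 0 j ^+ 2).

Definition supp x : {set 'I_d} := finset (fun j => x 0 j != 0).

Definition indicator_vec (A : {set 'I_d}) : 'rV[R]_d := \row_j (j \in A)%:R.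

Definition weighted_l1 w x : R := \sum_j w 0 j * `|x 0 j|.

Definition descent_cone (f : 'rV[R]_d -> R) x0 : set 'rV[R]_d :=
  [set v | exists2 tau : R, 0 < tau & f (x0 + tau *: v) <= f x0].

(** The nearest point of [C] to [x]; it exists and is unique when [C] is
    nonempty, closed and convex (otherwise [0] is returned if no nearest point
    exists). *)
Definition metric_proj C x : 'rV[R]_d :=
  xget 0 [set p | C p /\ forall q, C q -> norm2 (x - p) <= norm2 (x - q)].

End Vectors.

Section StdGaussian.
Context {R : realType}.
Local Notation RR := (measurableTypeR R).

Definition tuple_cons n (x : RR * n.-tuple RR) : n.+1.-tuple RR :=
  [tuple of x.1 :: x.2].

Lemma measurable_tuple_cons n : measurable_fun [set: _] (@tuple_cons n).
Proof. exact: measurable_cons. Qed.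

HB.instance Definition _ n :=
  isMeasurableFun.Build _ _ _ _ (@tuple_cons n) (@measurable_tuple_cons n).

(** The law of [n] independent N(0,1) variables: the [n]-fold product of
    [normal_prob 0 1] (see [std_gaussian_box]), built by iterating the binary
    product measure and transporting it along [tuple_cons]. *)
Fixpoint std_gaussian n : probability (n.-tuple RR) R :=
  if n is m.+1 then
    distribution (normal_prob 0 1 \x std_gaussian m)%E (@tuple_cons m)
  else \d_ ([tuple] : 0.-tuple RR).

Lemma std_gaussian_box n (A : 'I_n -> set RR) :
  (forall i, measurable (A i)) ->
  std_gaussian n [set t | forall i, A i (tnth t i)] =
    (\prod_(i < n) normal_prob 0 1 (A i))%E.
Proof.
elim: n A => [|n IH] A mA /=.
  rewrite big_ord0 diracE mem_set//= => -[]//.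
rewrite big_ord_recl -IH; last by move=> i; exact: mA.
rewrite -product_measure1E//; last first.
  rewrite (_ : [set t | _] =
      \bigcap_(i in [set: 'I_n]) [set t : n.-tuple RR | A (lift ord0 i) (tnth t i)]).
    apply: fin_bigcap_measurable => // i _.
    have := @measurable_tnth _ RR n i measurableT _ (mA (lift ord0 i)).
    by rewrite setTI.
  by apply/seteqP; split=> t /= tA i; [move=> _; exact: tA|exact: (tA i I)].
rewrite /distribution /pushforward; congr (_ _).
apply/seteqP; split=> -[x t] /=.
  move=> xtA; split; first by have := xtA ord0; rewrite tnth0.
  by move=> i; have := xtA (lift ord0 i); rewrite tnthS.
move=> [xA tA] i; case: (unliftP ord0 i) => [j ->|->].
  by rewrite tnthS; exact: tA.
by rewrite tnth0.
Qed.

(** A standard Gaussian vector in R^d, defined on the probability space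
    [std_gaussian d]. *)
Definition gaussian_vec d (t : d.-tuple RR) : 'rV[R]_d := \row_j tnth t j.

(** Taking the closure covers general convex cones; it changes nothing when [C]
    is closed. *)
Definition stat_dim d (C : set 'rV[R]_d) : \bar R :=
  ('E_(std_gaussian d)
     [fun t => (norm2 (metric_proj (closure C) (gaussian_vec t)) ^+ 2)%R])%E.

End StdGaussian.

Section SampleComplexity.
Context {R : realType}.

Definition phi (t : R) : R :=
  Num.sqrt (2 / pi) *
  \int[lebesgue_measure]_(x in `[t, +oo[) ((x - t) ^+ 2 * expR (- x ^+ 2 / 2)).

Context {d k : nat}.
Implicit Types (S : 'I_k -> {set 'I_d}) (T : {set 'I_d}) (omega : 'I_k -> R).

(** [S] lists the blocks of a partition of the index set without repetition. *)
Definition is_partition S : Prop :=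
  injective S /\ finset.partition (S @: [set: 'I_k])%SET [set: 'I_d]%SET.

Definition rho S i : R := #|S i|%:R / d%:R.

Definition alpha S T i : R := #|T :&: S i|%:R / #|S i|%:R.

(** The default value [1] is harmless, since [alpha S T i <= 1]. *)
Definition alpha_min S T : R := \big[Order.min/1]_(i < k) alpha S T i.

Definition block_weights S omega : 'rV[R]_d :=
  \sum_(i < k) omega i *: indicator_vec (S i).

Definition m_tilde S T omega : R :=
  inf [set #|T|%:R / d%:R +
           \sum_(i < k) rho S i *
             (alpha S T i * (omega i * tau) ^+ 2 +
              (1 - alpha S T i) * phi (omega i * tau))
      | tau in [set tau : R | 0 < tau]].

End SampleComplexity.

(* Main.v *)
Require Import Defs.
From HB Require Import structures.
From mathcomp Require Import all_boot all_order all_algebra.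
From mathcomp Require Import all_classical all_reals all_analysis.
From mathcomp Require Import measurable_realfun ring lra.
Set Implicit Arguments.
Unset Strict Implicit.
Unset Printing Implicit Defensive.
Import Order.TTheory GRing.Theory Num.Theory.
Import numFieldNormedType.Exports.
Local Open Scope classical_set_scope.
Local Open Scope ring_scope.

(** The descent cone of the weighted norm at [x0] is the closed set where the
    directional derivative of the norm is nonpositive, and its polar cone is
    generated by the subdifferential ([descent_cone_l1E]).  By Moreau's
    decomposition the squared norm of the projection of [u] onto the cone is the
    minimum over [t >= 0] of the squared distance [F u t] from [u] to [t] times
    the subdifferential ([norm2_proj_descent_cone]).  The distance splits over
    the coordinates, and its Gaussian expectation [J t], divided by [d], is the
    function minimized in [m_tilde] ([Rintegral_soft_threshold],
    [sample_complexity_expected_dist]).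

    The upper bound is the inequality between the expectation of a minimum and
    the minimum of the expectations.

    For the lower bound let [r u] be the minimizer of [F u] over the whole line and
    [tau] its expectation.  Convexity bounds [F u tau - F u (r u)] by the
    derivative of [F u] at [tau] times [tau - r u].  As [tau] is the mean of [r],
    the expectation of this product is a covariance, and since the derivative at
    [tau] is a sum of functions of single coordinates, it is a sum of covariances
    in one Gaussian variable.  A consequence of Stein's identity
    ([gaussian_covariance_le]) bounds the [j]-th one, up to the factor 2 of the
    derivative, by the weight [w j] times the expected partial derivative of [r]
    in the [j]-th coordinate.  By the implicit function theorem this partial
    derivative is [w j] divided by the sum of the squared weights of the
    coordinates where the residual is active, or 0 if [j] is not active; so the
    bounds add up to exactly 2 ([expected_dist_at_mean_root]).  Hence
    [m_tilde - 2 / d <= delta / d], and [2 / d] is at most either error term of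
    the statement since [abar <= 1 <= d].

    The minimizer [r] is only piecewise smooth.  Its partial derivatives are
    therefore used through increments: [r] is a convex function of each
    coordinate, so its increments lie below those of a primitive of the candidate
    derivative ([nondecreasing_slope_dominates]).  When all weights vanish [r] is
    not unique, but then the cone is the whole space and [F u] is constant. *)

(** * The standard Gaussian density *)

Section Gauss1.
Context {R : realType}.
Local Notation mu := (@lebesgue_measure R).
Local Notation gpdf := (normal_pdf (0 : R) 1).
Local Notation gam := (normal_prob (0 : R) 1).
Import HBNNSimple.

(** Transfer of Gaussian integrals to Lebesgue integrals against the density,
    where the fundamental theorem of calculus and reflection apply; proved on
    simple functions and extended by monotone convergence. *)
Lemma ge0_integral_normal_prob (m s : R) (f : _ -> \bar R) :
  measurable_fun setT f -> (forall x, 0 <= f x)%E ->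
  (\int[normal_prob m s]_x f x = \int[mu]_x (f x * (normal_pdf m s x)%:E))%E.
Proof.
move=> mf f0; pose f_ := nnsfun_approx measurableT mf.
have mpdf : measurable_fun [set: measurableTypeR R] (EFin \o normal_pdf m s).
  by apply/measurable_EFinP; exact: measurable_normal_pdf.
have pdf0 x : (0 <= (normal_pdf m s x)%:E)%E by rewrite lee_fin normal_pdf_ge0.
have fE x : f x = limn (fun n => (f_ n x)%:E).
  by apply/esym/cvg_lim => //; exact: cvg_nnsfun_approx.
transitivity (limn (fun n => \int[normal_prob m s]_x (f_ n x)%:E))%E.
  rewrite -monotone_convergence//=.
  - by apply: eq_integral => ? _.
  - by move=> n; exact/measurable_EFinP/measurable_funTS.
  - by move=> n ? _; rewrite lee_fin.
  - by move=> ? _ ? ? mn; rewrite lee_fin; exact/lefP/nd_nnsfun_approx.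
transitivity (limn (fun n => \int[mu]_x ((f_ n x)%:E * (normal_pdf m s x)%:E)))%E;
    last first.
  rewrite -monotone_convergence//=.
  - apply: eq_integral => x _; rewrite fE muleC -limeMl//.
      apply: congr_lim; apply/funext => n; exact: muleC.
      apply/cvg_ex; exists (f x); exact: cvg_nnsfun_approx.
  - move=> n; apply: emeasurable_funM => //.
    exact/measurable_EFinP/measurable_funTS.
  - by move=> n x _; rewrite mule_ge0// lee_fin.
  - move=> x _ a b ab; rewrite lee_wpmul2r// lee_fin.
    exact/lefP/nd_nnsfun_approx.
apply: congr_lim; apply/funext => n.
under eq_integral do rewrite fimfunE -fsumEFin//.
rewrite ge0_integral_fsum//; last 2 first.
  - by move=> r; exact/measurable_EFinP/measurableT_comp.
  - by move=> k x _; rewrite EFinM nnfun_muleindic_ge0.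
under [RHS]eq_integral.
  move=> x _; rewrite fimfunE -fsumEFin// muleC ge0_mule_fsumr; last first.
    by move=> r; rewrite EFinM nnfun_muleindic_ge0.
  over.
rewrite ge0_integral_fsum//; last 2 first.
  - move=> r; apply: emeasurable_funM => //.
    by apply/measurable_EFinP; do 2 apply/measurableT_comp => //.
  - by move=> k x _; rewrite mule_ge0// EFinM nnfun_muleindic_ge0.
apply: eq_fsbigr => r _.
have mE : measurable (f_ n @^-1` [set r]) by exact: measurable_sfunP.
rewrite integralZl_indic_nnsfun// integral_indic// setIT.
have [r0|r0] := leP 0 r; last first.
  rewrite preimage_nnfun0// measure0 mule0.
  by under eq_integral do rewrite indic0 mulr0 mule0; rewrite integral0.
transitivity (\int[mu]_x (r%:E * ((normal_pdf m s x)%:E *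
   (\1_(f_ n @^-1` [set r]) x)%:E)))%E; last first.
  by apply: eq_integral => x _; rewrite EFinM muleCA.
rewrite ge0_integralZl//; last 2 first.
- apply: emeasurable_funM => //.
  by apply/measurable_EFinP; exact: measurable_indic.
- by move=> x _; rewrite mule_ge0// lee_fin.
congr (_ * _)%E.
transitivity (\int[mu]_(x in f_ n @^-1` [set r]) (normal_pdf m s x)%:E)%E; first by [].
rewrite [LHS]integral_mkcond.
apply: eq_integral => x _; rewrite patchE indicE.
by case: ifPn => xE; rewrite ?mule1 ?mule0.
Qed.

Lemma std_normal_pdfE x : gpdf x = normal_peak 1 * expR (- x ^+ 2 / 2).
Proof.
by rewrite normal_pdfE ?oner_eq0// /normal_fun subr0 expr1n.
Qed.

Lemma std_normal_pdfN x : gpdf (- x) = gpdf x.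
Proof. by rewrite !std_normal_pdfE sqrrN. Qed.

Lemma is_derive_std_normal_pdf (x : R) : is_derive x 1 (fun y => - gpdf y) (x * gpdf x).
Proof.
have -> : (fun y => - gpdf y) = (fun y => - (normal_peak 1 * expR (- y ^+ 2 / 2))).
  by apply/funext => y; rewrite std_normal_pdfE.
have h : is_derive x 1 (fun y : R => - y ^+ 2 / 2) (- x).
  apply: is_derive_eq; rewrite scaler0 ?addr0 ?add0r /GRing.scale/=.
  by field.
have h2 := @is_derive1_comp R expR _ x _ _ (is_derive_expR _) h.
have -> : (fun y : R => - (normal_peak 1 * expR (- y ^+ 2 / 2))) =
   (- normal_peak 1) \*: (expR \o (fun y : R => - y ^+ 2 / 2)).
  by apply/funext => y; rewrite /= scaleNr.
apply: is_derive_eq; rewrite std_normal_pdfE /GRing.scale/=.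
by ring.
Qed.

(** The function [x * gpdf x] is the derivative of [- gpdf], which vanishes at
    infinity; this identity is the whole analytic content of Stein's lemma. *)
Lemma integral_id_std_normal_pdf (t : R) : 0 <= t ->
  (\int[mu]_(x in `[t, +oo[) (x * gpdf x)%:E = (gpdf t)%:E)%E.
Proof.
move=> t0.
have cpdf : continuous gpdf by apply: continuous_normal_pdf; rewrite oner_eq0.
rewrite (@ge0_continuous_FTC2y R _ (fun y => - gpdf y) t 0).
- by rewrite EFinN oppeK add0e.
- by move=> x tx; rewrite mulr_ge0 ?normal_pdf_ge0// (le_trans t0).
- apply: continuous_subspaceT => x.
  by apply: cvgM; [exact: cvg_id|exact: cpdf].
- suff h : gpdf y @[y --> +oo%R] --> (0 : R).
    have h2 : (- gpdf) y @[y --> +oo%R] --> (- 0 : R) by apply: cvgN.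
    rewrite oppr0 in h2.
    exact: h2.
  have -> : gpdf = (fun y => normal_peak 1 * gauss_fun (y / Num.sqrt 2)).
    apply/funext => y; rewrite std_normal_pdfE /gauss_fun; congr (_ * expR _).
    by rewrite exprMn exprVn sqr_sqrtr// mulNr.
  rewrite -(mulr0 (normal_peak 1)); apply: cvgM; first exact: cvg_cst.
  apply: (cvg_comp (fun y => y / Num.sqrt 2) gauss_fun); last exact: cvg_gauss_fun.
  by apply/gt0_cvgMly; [rewrite invr_gt0 sqrtr_gt0|exact: cvg_id].
- by move=> x _; have [] := is_derive_std_normal_pdf x.
- apply: cvgN; apply: cvg_at_right_filter; exact: cpdf.
- move=> x _; rewrite derive1E; have := is_derive_std_normal_pdf x.
  by move=> ?; rewrite derive_val.
Qed.
End Gauss1.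

(** * Comparing increments with integrals *)

Section Dominate.
Context {R : realType}.
Implicit Types (f p P : R -> R).

(** A discrete form of the fundamental theorem of calculus.  Here [p] need not be
    the derivative of [f]: a bound of each increment by the value of [p] at the
    right end point suffices.  On a grid of mesh [h] the right Riemann sum of a
    nondecreasing [p] exceeds the left one, which lies below the increment of
    [P], by the telescoping sum [h * (p b - p a)]. *)
Lemma nondecreasing_slope_dominates f p P a b : a <= b ->
  (forall x y m, x <= y -> (forall t, x <= t <= y -> m <= p t) ->
     m * (y - x) <= P y - P x) ->
  (forall x y, a <= x -> x <= y -> y <= b -> p x <= p y) ->
  (forall x y, a <= x -> x <= y -> y <= b -> `|f y - f x| <= (y - x) * p y) ->
  `|f b - f a| <= P b - P a.
Proof.
move=> ab hP hp hf; apply/ler_addgt0Pr => e e0.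
have pab : 0 <= p b - p a by rewrite subr_ge0 hp.
(* enough grid points to make the telescoping error at most [e] *)
pose N := (Num.truncn ((b - a) * (p b - p a) / e)).+1.
have N0 : 0 < N%:R :> R by rewrite ltr0n.
have hN : (b - a) / N%:R * (p b - p a) <= e.
  rewrite mulrAC ler_pdivrMr// -ler_pdivrMl// mulrC ltW//.
  exact: truncnS_gt.
set h := (b - a) / N%:R in hN.
have h0 : 0 <= h by rewrite divr_ge0// subr_ge0.
have Nh : a + N%:R * h = b by rewrite /h mulrC divfK ?gt_eqF// addrC subrK.
(* the two extra terms absorb the difference of right and left Riemann sums *)
have step k : (k <= N)%N ->
    `|f (a + k%:R * h) - f a| + h * p a <= P (a + k%:R * h) - P a + h * p (a + k%:R * h).
  elim: k => [|k IH] kN; first by rewrite mul0r addr0 !subrr normr0.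
  have {IH} := IH (ltnW kN).
  have ek : a + k.+1%:R * h = (a + k%:R * h) + h by rewrite -natr1; ring.
  set u := a + k%:R * h in ek *.
  have au : a <= u by rewrite lerDl mulr_ge0.
  have ub : u + h <= b by rewrite -ek -Nh lerD2l ler_wpM2r// ler_nat.
  have uh : u <= u + h by rewrite lerDl.
  have huE : u + h - u = h by ring.
  have h1 := hf _ _ au uh ub.
  have h2 : p u * h <= P (u + h) - P u.
    have := hP u (u + h) (p u) uh; rewrite huE; apply.
    move=> t /andP[ut tu]; apply: hp => //; exact: le_trans tu ub.
  have h3 : `|f (u + h) - f a| <= `|f (u + h) - f u| + `|f u - f a|.
    exact: ler_distD.
  rewrite ek; move: h1; rewrite huE => h1 h4.
  by rewrite [h * p a]mulrC in h4 *; rewrite [h * p u]mulrC in h4; lra.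
have := step N (leqnn _); rewrite Nh => h1.
by move: hN; rewrite mulrBr; lra.
Qed.

(** The previous lemma read through the reflection [x |-> - x]. *)
Lemma nonincreasing_slope_dominates f p P a b : a <= b ->
  (forall x y m, x <= y -> (forall t, x <= t <= y -> m <= p t) ->
     m * (y - x) <= P y - P x) ->
  (forall x y, a <= x -> x <= y -> y <= b -> p y <= p x) ->
  (forall x y, a <= x -> x <= y -> y <= b -> `|f y - f x| <= (y - x) * p x) ->
  `|f b - f a| <= P b - P a.
Proof.
move=> ab hP hp hf.
have := @nondecreasing_slope_dominates (f \o -%R) (p \o -%R)
  (fun x => - P (- x)) (- b) (- a).
rewrite /= !opprK distrC => h.
have -> : P b - P a = - P a + P b by rewrite addrC.
apply: h; first by rewrite lerN2.
- move=> x y m xy hm; rewrite opprK [leRHS]addrC.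
  have -> : y - x = - x - (- y) by rewrite opprK addrC.
  apply: hP; first by rewrite lerN2.
  by move=> t /andP[yt tx]; rewrite -(opprK t) hm// lerNr tx lerNl yt.
- move=> x y bx xy ya; apply: hp; first by rewrite lerNr.
    by rewrite lerN2.
  by rewrite lerNl.
- move=> x y bx xy ya; rewrite distrC.
  have -> : y - x = - x - (- y) by rewrite opprK addrC.
  by apply: hf; [rewrite lerNr|rewrite lerN2|rewrite lerNl].
Qed.

End Dominate.

Section Primitive.
Context {R : realType}.
Local Notation RR := (measurableTypeR R).
Local Notation mu := (@lebesgue_measure R).
Local Notation gpdf := (normal_pdf (0 : R) 1).
Local Notation gam := (normal_prob (0 : R) 1).

Definition halfline_primitive (p : R -> R) (x : R) : R :=
  \int[mu]_(t in `[0, x]) p t.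

(** The signed integral of [p] from [0] to [x].  On the negative half-line it is
    written with the reflected function, so that Stein's identity on the line
    reduces to two instances of the identity on the positive half-line. *)
Definition primitive (p : R -> R) (x : R) : R :=
  if 0 <= x then halfline_primitive p x else - halfline_primitive (p \o -%R) (- x).

Lemma measurable_fun_natb d (T : measurableType d) (b : T -> bool) :
  measurable_fun [set: T] b -> measurable_fun [set: T] (fun x => (b x)%:R : R).
Proof.
move=> mb; rewrite (_ : (fun _ => _) = fun x => if b x then 1 else 0 : R).
  exact: measurable_fun_ifT.
by apply/funext => x; case: (b x).
Qed.

Section Bounded.
Variables (p : R -> R) (M : R).
Hypothesis mp : measurable_fun [set: RR] p.
Hypothesis p0 : forall t, 0 <= p t.
Hypothesis pM : forall t, p t <= M.

Lemma bounded_integrable (D : set RR) : measurable D -> (mu D < +oo)%E ->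
  mu.-integrable D (EFin \o p).
Proof.
move=> mD Dfin.
apply: (@le_integrable _ _ _ mu D mD _ (fun=> M%:E)).
- by apply/measurable_EFinP; apply: measurable_funTS.
- by move=> x Dx /=; rewrite lee_fin !ger0_norm// (le_trans (p0 x)).
- apply/integrableP; split; first exact: measurable_cst.
  by rewrite /= integral_cst//= lte_mul_pinfty// lee_fin.
Qed.

Lemma itv_bounded_integrable (a b : itv_bound R) (u v : R) :
  (BLeft u <= a)%O -> (b <= BRight v)%O ->
  mu.-integrable [set` Interval a b] (EFin \o p).
Proof.
move=> ua bv; apply: bounded_integrable => //.
apply: (@le_lt_trans _ _ (mu `[u, v])).
  apply: le_measure; rewrite ?inE//.
  by apply: subset_itvScc.
by rewrite lebesgue_measure_itv /=; case: ifP => _; rewrite ?ltry// -EFinB ltry.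
Qed.

Lemma halfline_primitive_EFin x :
  ((halfline_primitive p x)%:E = \int[mu]_(t in `[0%R, x]) (p t)%:E)%E.
Proof.
rewrite /halfline_primitive /Rintegral fineK//; apply: integrable_fin_num => //.
exact: (@itv_bounded_integrable _ _ 0 x).
Qed.

Lemma halfline_primitive_ge0 x : 0 <= halfline_primitive p x.
Proof. exact: Rintegral_ge0. Qed.

Lemma halfline_primitive0 : halfline_primitive p 0 = 0.
Proof. by rewrite /halfline_primitive set_itv1 Rintegral_set1. Qed.

(** The only property of the integral used to compare it with increments. *)
Lemma halfline_primitive_slope x y m : 0 <= x -> x <= y ->
  (forall t, x <= t <= y -> m <= p t) ->
  m * (y - x) <= halfline_primitive p y - halfline_primitive p x.
Proof.
move=> x0 xy hm; rewrite /halfline_primitive Rintegral_itvB ?bnd_simp//; last first.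
  exact: (@itv_bounded_integrable _ _ 0 y).
have -> : m * (y - x) = \int[mu]_(t in `]x, y]) (cst m) t.
  rewrite Rintegral_cst//= lebesgue_measure_itv/= lte_fin.
  by move: xy; rewrite le_eqVlt => /predU1P[->|->]; rewrite ?ltxx ?subrr ?mulr0// mulr0.
apply: le_Rintegral => //.
- apply/integrableP; split; first exact/measurable_EFinP/measurable_cst.
  rewrite /= integral_cst//= lte_mul_pinfty//.
  by rewrite lebesgue_measure_itv/=; case: ifP; rewrite ?ltry// -EFinB ltry.
- by apply: (@itv_bounded_integrable _ _ x y); rewrite bnd_simp.
- by move=> t /=; rewrite in_itv/= => /andP[xt ty]; apply: hm; rewrite ty ltW.
Qed.
End Bounded.
End Primitive.

(** * Stein's identity *)

Section Stein.
Context {R : realType}.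
Local Notation RR := (measurableTypeR R).
Local Notation mu := (@lebesgue_measure R).
Local Notation gpdf := (normal_pdf (0 : R) 1).
Local Notation gam := (normal_prob (0 : R) 1).

Section Half.
Variables (p : R -> R) (M : R).
Hypothesis mp : measurable_fun [set: RR] p.
Hypothesis p0 : forall t, 0 <= p t.
Hypothesis pM : forall t, p t <= M.

Lemma measurable_between :
  measurable_fun [set: RR * RR] (fun z : RR * RR => ((0 <= z.2) && (z.2 <= z.1))%:R : R).
Proof.
apply: measurable_fun_natb; apply: measurable_and; apply: measurable_fun_ler => //.
Qed.

Lemma halfline_primitive_indic x :
  ((halfline_primitive p x)%:E =
   \int[mu]_t (((0 <= t) && (t <= x))%R%:R * p t)%:E)%E.
Proof.
rewrite (halfline_primitive_EFin mp p0 pM) integral_mkcond.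
apply: eq_integral => t _; rewrite patchE mem_setE in_itv/=.
by case: (_ && _); rewrite ?mul1r ?mul0r.
Qed.

Lemma measurable_halfline_primitive : measurable_fun [set: RR] (halfline_primitive p).
Proof.
apply/measurable_EFinP.
rewrite (_ : _ \o _ = fubini_F mu (fun z : RR * RR =>
    (((0 <= z.2) && (z.2 <= z.1))%R%:R * p z.2)%:E)).
  apply: measurable_fun_fubini_tonelli_F.
    apply/measurable_EFinP; apply: measurable_funM; first exact: measurable_between.
    exact: measurableT_comp.
  by move=> z; rewrite lee_fin mulr_ge0.
by apply/funext => x; rewrite /= halfline_primitive_indic.
Qed.

(** Exchanging the order of integration over [0 <= t <= x] leaves the inner
    integral of [x * gpdf x] over [x >= t], which is [gpdf t]. *)
Lemma halfline_stein :
  (\int[mu]_(x in `[0%R, +oo[) (x * gpdf x * halfline_primitive p x)%:E =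
   \int[mu]_(t in `[0%R, +oo[) (p t * gpdf t)%:E)%E.
Proof.
have mg : measurable_fun [set: RR] gpdf by exact: measurable_normal_pdf.
pose F (z : RR * RR) :=
  (((0 <= z.2) && (z.2 <= z.1))%R%:R * p z.2 * (z.1 * gpdf z.1))%:E.
have mF : measurable_fun [set: RR * RR] F.
  apply/measurable_EFinP; apply: measurable_funM.
    apply: measurable_funM; first exact: measurable_between.
    exact: measurableT_comp.
  by apply: measurable_funM => //; exact: measurableT_comp.
have F0 z : (0 <= F z)%E.
  rewrite lee_fin; case: (boolP (_ && _)) => [/andP[z20 z21]|_]; last by rewrite !mul0r.
  by rewrite !mulr_ge0// ?normal_pdf_ge0// (le_trans z20).
have := @fubini_tonelli _ _ _ _ _ mu mu F mF F0.
have -> : (\int[mu]_x \int[mu]_y F (x, y) =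
   \int[mu]_(x in `[0%R, +oo[) (x * gpdf x * halfline_primitive p x)%:E)%E.
  rewrite [RHS]integral_mkcond; apply: eq_integral => x _.
  rewrite patchE mem_setE in_itv/= andbT; case: ifPn => [x0|]; last first.
    rewrite -ltNge => x0; apply: integral0_eq => y _; rewrite /F/=.
    case: (boolP (_ && _)) => [/andP[y0 yx]|]; last by rewrite !mul0r.
    by have := lt_le_trans x0 (le_trans y0 yx); rewrite ltxx.
  rewrite EFinM halfline_primitive_indic -ge0_integralZl//=.
  - by apply: eq_integral => y _; rewrite -EFinM mulrC.
  - apply/measurable_EFinP; apply: measurable_funM => //.
    exact: (measurableT_comp measurable_between (pair1_measurable x)).
  - by move=> y _; rewrite lee_fin mulr_ge0.
  - by rewrite lee_fin mulr_ge0// normal_pdf_ge0.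
move=> ->; rewrite [RHS]integral_mkcond; apply: eq_integral => t _.
rewrite patchE mem_setE in_itv/= andbT; case: ifPn => [t0|/negPf t0]; last first.
  by apply: integral0_eq => x _; rewrite /F/= t0 !mul0r.
transitivity (\int[mu]_(x in `[t, +oo[) ((p t)%:E * (x * gpdf x)%:E))%E.
  rewrite [RHS]integral_mkcond; apply: eq_integral => x _.
  rewrite patchE mem_setE in_itv/= andbT /F/= t0/=.
  by case: ifPn => _; rewrite ?mul0r ?mul1r.
rewrite ge0_integralZl//=; last 3 first.
- apply/measurable_funTS/measurable_EFinP; exact: measurable_funM.
- move=> x; rewrite in_itv/= andbT => tx.
  by rewrite lee_fin mulr_ge0 ?normal_pdf_ge0// (le_trans t0).
- by rewrite lee_fin.
by rewrite integral_id_std_normal_pdf.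
Qed.
End Half.
End Stein.

Section Stein2.
Context {R : realType}.
Local Notation RR := (measurableTypeR R).
Local Notation mu := (@lebesgue_measure R).
Local Notation gpdf := (normal_pdf (0 : R) 1).
Local Notation gam := (normal_prob (0 : R) 1).

(** Folds the line at the origin, reducing integrals over the line to the
    half-line. *)
Lemma ge0_integral_fold (g : RR -> \bar R) :
  measurable_fun [set: RR] g -> (forall x, 0 <= g x)%E ->
  (\int[mu]_x g x =
   \int[mu]_(x in `[0%R, +oo[) g x + \int[mu]_(x in `[0%R, +oo[) g (- x)%R)%E.
Proof.
move=> mg g0.
have mgN : measurable_fun [set: RR] (fun x : RR => g (- x)).
  by apply: (measurableT_comp mg); exact: oppr_measurable.
rewrite (@ge0_integration_by_substitution0 _ (fun x : RR => g (- x)))//.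
under [in X in (_ + X)%E]eq_integral do rewrite opprK.
rewrite -integral_itv_bndo_bndc; last by apply: measurable_funTS.
rewrite -(@ge0_integral_setU _ _ _ mu)//=.
- congr integral; apply/seteqP; split => // x _ /=.
  by rewrite !in_itv/= andbT; case: (leP 0 x) => h; [left|right].
- exact: measurable_funTS.
- apply/disj_setPS => x [] /=; rewrite !in_itv/= andbT => x0.
  by rewrite ltNge x0.
Qed.

Lemma ge0_integral_std_normalN (g : RR -> \bar R) :
  measurable_fun [set: RR] g -> (forall x, 0 <= g x)%E ->
  (\int[gam]_x g (- x)%R = \int[gam]_x g x)%E.
Proof.
move=> mg g0.
have mpdf : measurable_fun [set: RR] (EFin \o gpdf).
  by apply/measurable_EFinP; exact: measurable_normal_pdf.
have mgN : measurable_fun [set: RR] (fun x : RR => g (- x)).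
  by apply: (measurableT_comp mg); exact: oppr_measurable.
rewrite ge0_integral_normal_prob// ge0_integral_normal_prob//.
rewrite ge0_integral_fold; last 2 first.
  - exact: emeasurable_funM.
  - by move=> x; rewrite mule_ge0// lee_fin normal_pdf_ge0.
rewrite [RHS]ge0_integral_fold; last 2 first.
  - exact: emeasurable_funM.
  - by move=> x; rewrite mule_ge0// lee_fin normal_pdf_ge0.
rewrite [LHS]addeC; apply: f_equal2; apply: eq_integral => x _.
  by rewrite opprK std_normal_pdfN.
by rewrite std_normal_pdfN.
Qed.

Section Full.
Variables (p : R -> R) (M : R).
Hypothesis mp : measurable_fun [set: RR] p.
Hypothesis p0 : forall t, 0 <= p t.
Hypothesis pM : forall t, p t <= M.

Let mpN : measurable_fun [set: RR] (p \o -%R).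
Proof. by apply: (measurableT_comp mp); exact: oppr_measurable. Qed.

Lemma measurable_primitive : measurable_fun [set: RR] (primitive p).
Proof.
apply: measurable_fun_ifT.
- exact: measurable_fun_ler.
- exact: (measurable_halfline_primitive mp p0 pM).
- apply: (measurableT_comp (@oppr_measurable R setT)).
  have mH := measurable_halfline_primitive mpN (fun t => p0 (- t)) (fun t => pM (- t)).
  exact: (measurableT_comp mH (@oppr_measurable R setT)).
Qed.

Lemma primitive_slope x y m : x <= y -> (forall t, x <= t <= y -> m <= p t) ->
  m * (y - x) <= primitive p y - primitive p x.
Proof.
move=> xy hm.
have hpos u v : 0 <= u -> u <= v -> (forall t, u <= t <= v -> m <= p t) ->
    m * (v - u) <= primitive p v - primitive p u.
  move=> u0 uv h; rewrite /primitive u0 (le_trans u0 uv).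
  exact: (halfline_primitive_slope mp p0 pM).
have pri0 : primitive p 0 = 0 by rewrite /primitive lexx halfline_primitive0.
have hneg u v : u <= v -> v <= 0 -> (forall t, u <= t <= v -> m <= p t) ->
    m * (v - u) <= primitive p v - primitive p u.
  move=> uv v0 h.
  have E z : z <= 0 -> primitive p z = - halfline_primitive (p \o -%R) (- z).
    rewrite le_eqVlt => /predU1P[->|z0]; last by rewrite /primitive leNgt z0.
    by rewrite pri0 oppr0 halfline_primitive0 oppr0.
  rewrite !E//; last exact: le_trans uv v0.
  rewrite opprK [leRHS]addrC.
  have -> : v - u = - u - - v by rewrite opprK addrC.
  apply: (halfline_primitive_slope mpN (fun t => p0 (- t)) (fun t => pM (- t))).
  - by rewrite oppr_ge0.
  - by rewrite lerN2.
  - by move=> t /andP[vt tu]; apply: h; rewrite lerNr tu lerNl vt.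
have [x0|x0] := leP 0 x; first exact: hpos.
have [y0|y0] := leP y 0; first exact: hneg.
have -> : m * (y - x) = m * (y - 0) + m * (0 - x) by ring.
have h1 : m * (0 - x) <= primitive p 0 - primitive p x.
  apply: hneg => //; first exact: ltW.
  by move=> t /andP[xt t0]; rewrite hm// xt (le_trans t0)// ltW.
have h2 : m * (y - 0) <= primitive p y - primitive p 0.
  apply: hpos => //; first exact: ltW.
  by move=> t /andP[t0 ty]; rewrite hm// ty (le_trans (ltW x0)).
by have := lerD h2 h1; rewrite addrA subrK.
Qed.

Lemma primitive0 : primitive p 0 = 0.
Proof. by rewrite /primitive lexx halfline_primitive0. Qed.

Lemma primitive_nondecreasing x y : x <= y -> primitive p x <= primitive p y.
Proof.
move=> xy; rewrite -subr_ge0; have := primitive_slope xy (fun t _ => p0 t).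
by rewrite mul0r.
Qed.

Lemma normr_primitive_le x : `|primitive p x| <= M * `|x|.
Proof.
have H (q : R -> R) z : measurable_fun [set: RR] q -> (forall t, 0 <= q t) ->
    (forall t, q t <= M) -> (0 <= z)%R -> `|halfline_primitive q z| <= M * z.
  move=> mq q0 qM z0; rewrite (ger0_norm (halfline_primitive_ge0 q0 z)).
  rewrite /halfline_primitive.
  have -> : M * z = \int[mu]_(t in `[0, z]) (cst M) t.
    rewrite Rintegral_cst//= lebesgue_measure_itv/= lte_fin oppr0 adde0.
    by move: z0; rewrite le_eqVlt => /predU1P[<-|->]; rewrite ?ltxx.
  apply: le_Rintegral => //.
  - by apply: (itv_bounded_integrable mq q0 qM (u := 0) (v := z)).
  - apply/integrableP; split; first exact/measurable_EFinP/measurable_cst.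
    rewrite /= integral_cst//= lte_mul_pinfty//.
    by rewrite lebesgue_measure_itv/=; case: ifP; rewrite ?ltry// -EFinB ltry.
rewrite /primitive; case: ifPn => [x0|]; first by rewrite [`|x|]ger0_norm// H.
rewrite -ltNge => x0; rewrite normrN [`|x|]ltr0_norm//.
have := H (p \o -%R) (- x) mpN (fun t => p0 (- t)) (fun t => pM (- t)).
by apply; rewrite oppr_ge0 ltW.
Qed.

Lemma id_primitive_ge0 x : 0 <= x * primitive p x.
Proof.
have [x0|x0] := leP 0 x.
  by have := primitive_nondecreasing x0; rewrite primitive0 => h; exact: mulr_ge0.
have := primitive_nondecreasing (ltW x0); rewrite primitive0 => h.
by rewrite mulr_le0// ltW.
Qed.

(** Stein's identity for the primitive of a bounded nonnegative function; the
    integrand on the left is nonnegative, so no integrability is at stake. *)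
Lemma gaussian_stein :
  (\int[gam]_x (x * primitive p x)%:E = \int[gam]_x (p x)%:E)%E.
Proof.
have mg : measurable_fun [set: RR] gpdf by exact: measurable_normal_pdf.
have mP := measurable_primitive.
rewrite ge0_integral_normal_prob; last 2 first.
  - by apply/measurable_EFinP; apply: measurable_funM.
  - by move=> x; rewrite lee_fin id_primitive_ge0.
rewrite [RHS]ge0_integral_normal_prob; last 2 first.
  - exact/measurable_EFinP.
  - by move=> x; rewrite lee_fin.
rewrite ge0_integral_fold; last 2 first.
  - apply/measurable_EFinP; apply: measurable_funM => //.
    exact: measurable_funM.
  - by move=> x; rewrite mule_ge0// lee_fin ?normal_pdf_ge0// id_primitive_ge0.
rewrite [RHS]ge0_integral_fold; last 2 first.
  - by apply/measurable_EFinP; apply: measurable_funM.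
  - by move=> x; rewrite mule_ge0// lee_fin ?normal_pdf_ge0.
congr (_ + _)%E.
  rewrite -(halfline_stein mp p0 pM); apply: eq_integral => x.
  rewrite inE/= in_itv/= andbT => x0.
  by rewrite /primitive x0 -EFinM; congr EFin; ring.
transitivity (\int[mu]_(t in `[0%R, +oo[) (p (- t) * gpdf t)%:E)%E; last first.
  by apply: eq_integral => x _; rewrite std_normal_pdfN.
rewrite -(halfline_stein mpN (fun t => p0 (- t)) (fun t => pM (- t))).
apply: eq_integral => x; rewrite inE/= in_itv/= andbT le_eqVlt.
case/predU1P => [<-|x0]; first by rewrite oppr0 !mul0r ?mul0e.
rewrite std_normal_pdfN -EFinM {1}/primitive oppr_ge0 leNgt x0/= opprK.
by congr EFin; ring.
Qed.
End Full.

(** Stein's identity with [p = 1]. *)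
Lemma integral_sqr_std_normal : (\int[gam]_x (x ^+ 2)%:E = 1)%E.
Proof.
transitivity (\int[gam]_x (x * primitive (fun=> 1%R) x)%:E)%E.
  apply: eq_integral => x _; congr EFin; rewrite expr2; congr (_ * _).
  have H z : 0 <= z -> halfline_primitive (fun=> 1) z = z.
    move=> z0; rewrite /halfline_primitive Rintegral_cst//= lebesgue_measure_itv/=.
    rewrite lte_fin oppr0 adde0 mul1r.
    by move: z0; rewrite le_eqVlt => /predU1P[<-|->]; rewrite ?ltxx.
  rewrite /primitive; case: ifPn => [x0|]; first by rewrite H.
  by rewrite -ltNge => x0; rewrite /comp H ?opprK// oppr_ge0 ltW.
rewrite (gaussian_stein (M := 1))// integral_cst// mul1e.
exact: probability_setT.
Qed.
End Stein2.

(** * A Gaussian covariance inequality on the line *)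

Section Lin.
Context d (T : measurableType d) (R : realType) (P : probability T R).
Implicit Types f : T -> R.

(** Expanding a product of two differences of functions, with one argument
    frozen, gives an expression of this shape. *)
Lemma integrable_affine3 f1 f2 f3 (c2 c3 c : R) :
  P.-integrable setT (EFin \o f1) -> P.-integrable setT (EFin \o f2) ->
  P.-integrable setT (EFin \o f3) ->
  P.-integrable setT (EFin \o (fun x => f1 x + c2 * f2 x + c3 * f3 x + c)).
Proof.
move=> i1 i2 i3.
have ic : P.-integrable setT (EFin \o (fun=> c)) by exact: finite_measure_integrable_cst.
have i2' := integrableZl measurableT c2 i2.
have i3' := integrableZl measurableT c3 i3.
have := integrableD measurableT (integrableD measurableT (integrableD measurableT i1 i2') i3') ic.
by apply: eq_integrable => // x _; rewrite /= !EFinD !EFinM.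
Qed.

Lemma Rintegral_affine3 f1 f2 f3 (c2 c3 c : R) :
  P.-integrable setT (EFin \o f1) -> P.-integrable setT (EFin \o f2) ->
  P.-integrable setT (EFin \o f3) ->
  \int[P]_x (f1 x + c2 * f2 x + c3 * f3 x + c) =
  \int[P]_x f1 x + c2 * \int[P]_x f2 x + c3 * \int[P]_x f3 x + c.
Proof.
move=> i1 i2 i3.
have ic : P.-integrable setT (EFin \o (fun=> c)) by exact: finite_measure_integrable_cst.
have i2' : P.-integrable setT (EFin \o (fun x => c2 * f2 x)).
  have := integrableZl measurableT c2 i2.
  by apply: eq_integrable => // x _; rewrite /= !EFinM.
have i3' : P.-integrable setT (EFin \o (fun x => c3 * f3 x)).
  have := integrableZl measurableT c3 i3.
  by apply: eq_integrable => // x _; rewrite /= !EFinM.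
have i12 : P.-integrable setT (EFin \o (fun x => f1 x + c2 * f2 x)).
  have := integrableD measurableT i1 i2'.
  by apply: eq_integrable => // x _; rewrite /= !EFinD.
have i123 : P.-integrable setT (EFin \o (fun x => f1 x + c2 * f2 x + c3 * f3 x)).
  have := integrableD measurableT i12 i3'.
  by apply: eq_integrable => // x _; rewrite /= !EFinD.
rewrite RintegralD// RintegralD// RintegralD// RintegralZl// RintegralZl//.
by rewrite Rintegral_cst//= probability_setT/= mulr1.
Qed.
End Lin.

Section Cov.
Context {R : realType}.
Local Notation RR := (measurableTypeR R).
Local Notation mu := (@lebesgue_measure R).
Local Notation gam := (normal_prob (0 : R) 1).

Lemma std_normal_integrable (f : R -> R) C : measurable_fun [set: RR] f ->
  (forall x, `|f x| <= C * (1 + x ^+ 2)) -> gam.-integrable setT (EFin \o f).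
Proof.
move=> mf fC.
have i2 : gam.-integrable setT (EFin \o (fun x : RR => x ^+ 2)).
  apply/integrableP; split; first exact/measurable_EFinP/measurable_funX.
  under eq_integral do rewrite /= ger0_norm ?sqr_ge0//.
  by rewrite integral_sqr_std_normal ltry.
have i1 : gam.-integrable setT (EFin \o (fun=> 1)).
  exact: finite_measure_integrable_cst.
have := integrableZl measurableT C (integrableD measurableT i1 i2).
apply: le_integrable => //; first exact/measurable_EFinP.
move=> x _ /=; rewrite lee_fin (le_trans (fC x))//.
exact: ler_norm.
Qed.

Lemma Rintegral_sqr_std_normal : \int[gam]_x x ^+ 2 = 1.
Proof. by rewrite /Rintegral integral_sqr_std_normal. Qed.

Lemma Rintegral_id_std_normal : \int[gam]_x x = 0.
Proof.
rewrite /Rintegral integralE.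
have -> : (\int[gam]_x (fun x : RR => x%:E)^\- x = \int[gam]_x (fun x : RR => x%:E)^\+ x)%E.
  rewrite -[RHS]ge0_integral_std_normalN//.
  2:by apply: measurable_funepos; exact/measurable_EFinP.
  by apply: eq_integral => x _; rewrite funenegE funeposE EFinN.
set a := (\int[_]_x _)%E.
by case: a => [r| |]//=; rewrite subrr.
Qed.

Lemma ler_sqr_normD (u b g : R) : `|u| <= `|b| + g -> u ^+ 2 <= 2 * b ^+ 2 + 2 * g ^+ 2.
Proof.
move=> h; rewrite -[u ^+ 2]real_normK ?num_real// -[b ^+ 2]real_normK ?num_real//.
have : `|u| ^+ 2 <= (`|b| + g) ^+ 2 by rewrite ler_sqr ?nnegrE// (le_trans _ h).
by have := sqr_ge0 (`|b| - g); nra.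
Qed.

Lemma normr_le_1Dsqr (x : R) : `|x| <= 1 + x ^+ 2.
Proof. by rewrite ler_norml; apply/andP; split; nra. Qed.

Lemma std_normal_integrable_lin (f : R -> R) C : measurable_fun [set: RR] f ->
  (forall x, `|f x| <= C * (1 + `|x|)) -> gam.-integrable setT (EFin \o f).
Proof.
move=> mf fC; apply: (@std_normal_integrable _ (2 * C)) => // x.
have C0 : 0 <= C by have := fC 0; rewrite normr0 addr0 mulr1; exact: le_trans.
have := normr_le_1Dsqr x; have := sqr_ge0 x; have := fC x; nra.
Qed.

Lemma std_normal_integrable_mul (f g : R -> R) C D :
  measurable_fun [set: RR] f -> measurable_fun [set: RR] g ->
  (forall x, `|f x| <= C * (1 + `|x|)) -> (forall x, `|g x| <= D * (1 + `|x|)) ->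
  gam.-integrable setT (EFin \o (fun x => f x * g x)).
Proof.
move=> mf mg fC gD; apply: (@std_normal_integrable _ (2 * (C * D))).
  exact: measurable_funM.
move=> x; rewrite normrM.
have := ler_pM (normr_ge0 _) (normr_ge0 _) (fC x) (gD x) => /le_trans; apply.
have C0 : 0 <= C by have := fC 0; rewrite normr0 addr0 mulr1; exact: le_trans.
have D0 : 0 <= D by have := gD 0; rewrite normr0 addr0 mulr1; exact: le_trans.
have -> : C * (1 + `|x|) * (D * (1 + `|x|)) = (C * D) * (1 + `|x|) ^+ 2 by ring.
rewrite [2 * _]mulrC -[leRHS]mulrA ler_wpM2l ?mulr_ge0//.
rewrite -[x ^+ 2]real_normK ?num_real//; have := sqr_ge0 (1 - `|x|); nra.
Qed.

Lemma lipschitz_growth (f : R -> R) L :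
  (forall x y, `|f x - f y| <= L * `|x - y|) -> forall x, `|f x| <= (`|f 0| + L) * (1 + `|x|).
Proof.
move=> fL x; have := fL x 0; rewrite subr0 => h.
have L0 : 0 <= L by have := fL 1 0; rewrite subr0 normr1 mulr1; exact: le_trans.
have : `|f x| <= `|f x - f 0| + `|f 0| by rewrite -[X in `|X| <= _](subrK (f 0)) ler_normD.
have := normr_ge0 (f 0); have := normr_ge0 x; nra.
Qed.

(** A Gaussian covariance inequality for functions that are controlled only
    through their increments.  Twice the covariance of [H] and [f] is the double
    integral of [(H x - H y) * (f x - f y)]; since the primitive [P] of [p] is
    nondecreasing this integrand is at most [L * (x - y) * (P x - P y)], whose
    double integral is twice [L] times the integral of [x * P x], and Stein's
    identity evaluates the latter. *)
Lemma gaussian_covariance_le (H f p : R -> R) (L M : R) :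
  measurable_fun [set: RR] H -> measurable_fun [set: RR] f ->
  measurable_fun [set: RR] p ->
  (forall t, 0 <= p t) -> (forall t, p t <= M) ->
  (forall x y, `|H x - H y| <= L * `|x - y|) ->
  (forall x y, x <= y -> `|f y - f x| <= primitive p y - primitive p x) ->
  \int[gam]_x (H x * f x) <=
  (\int[gam]_x H x) * (\int[gam]_x f x) + L * \int[gam]_x p x.
Proof.
move=> mH mf mp p0 pM HL fP.
have L0 : 0 <= L by have := HL 1 0; rewrite subr0 normr1 mulr1; exact: le_trans.
have M0 : 0 <= M by exact: le_trans (p0 0) (pM 0).
have mP := measurable_primitive mp p0 pM.
set P := primitive p in fP mP.
have PM x : `|P x| <= M * (1 + `|x|).
  apply: (le_trans (normr_primitive_le mp p0 pM x)).
  by rewrite ler_wpM2l// lerDr.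
have fG x : `|f x| <= (`|f 0| + M) * (1 + `|x|).
  have h : `|f x - f 0| <= `|P x|.
    have [x0|x0] := leP 0 x.
      have := fP _ _ x0; rewrite {2}/P primitive0 subr0 => /le_trans; apply.
      exact: ler_norm.
    have := fP _ _ (ltW x0); rewrite {1}/P primitive0 sub0r distrC => /le_trans; apply.
    by rewrite -normrN ler_norm.
  have : `|f x| <= `|f x - f 0| + `|f 0| by rewrite -[X in `|X| <= _](subrK (f 0)) ler_normD.
  have := PM x; have := normr_ge0 (f 0); have := normr_ge0 x; nra.
have HG := lipschitz_growth HL.
have IG x : `|x : R| <= 1 * (1 + `|x|) by rewrite mul1r lerDr.
have iH := std_normal_integrable_lin mH HG.
have if_ := std_normal_integrable_lin mf fG.
have iP := std_normal_integrable_lin mP PM.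
have iI := std_normal_integrable_lin (@measurable_id _ RR setT) IG.
have iHf := std_normal_integrable_mul mH mf HG fG.
have iIP := std_normal_integrable_mul (@measurable_id _ RR setT) mP IG PM.
set A := \int[gam]_x (H x * f x).
set a := \int[gam]_x H x; set b := \int[gam]_x f x.
have SE : \int[gam]_x (x * P x) = \int[gam]_x p x.
  by rewrite /Rintegral (gaussian_stein mp p0 pM).
set S := \int[gam]_x p x in SE *.
set c := \int[gam]_x P x.
have key x y : H x * f x + (- f y) * H x + (- H y) * f x + H y * f y <=
    L * (x * P x + (- P y) * x + (- y) * P x + y * P y).
  have -> : H x * f x + (- f y) * H x + (- H y) * f x + H y * f y =
     (H x - H y) * (f x - f y) by ring.
  have -> : x * P x + (- P y) * x + (- y) * P x + y * P y = (x - y) * (P x - P y) by ring.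
  rewrite (le_trans (ler_norm _))// normrM.
  have -> : (x - y) * (P x - P y) = `|x - y| * `|P x - P y|.
    rewrite -normrM ger0_norm//.
    have [xy|xy] := leP x y.
      rewrite -mulrNN !opprB mulr_ge0// ?subr_ge0//.
      exact: (primitive_nondecreasing mp p0 pM).
    rewrite mulr_ge0// ?subr_ge0//; first exact: ltW.
    by apply: (primitive_nondecreasing mp p0 pM); exact: ltW.
  rewrite mulrA ler_pM//.
  have [xy|xy] := leP x y.
    by rewrite distrC (le_trans (fP _ _ xy))// distrC ler_norm.
  by rewrite (le_trans (fP _ _ (ltW xy)))// ler_norm.
(* integration in the first variable *)
have key2 y : A + (- f y) * a + (- H y) * b + H y * f y <=
    L * (S + (- P y) * 0 + (- y) * c + y * P y).
  have := @le_Rintegral _ _ _ gam setT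
   (fun x => H x * f x + (- f y) * H x + (- H y) * f x + H y * f y)
   (fun x => L * (x * P x + (- P y) * x + (- y) * P x + y * P y)) measurableT.
  rewrite Rintegral_affine3// RintegralZl//; last exact: integrable_affine3.
  rewrite Rintegral_affine3// SE Rintegral_id_std_normal; apply.
  - exact: integrable_affine3.
  - have := integrableZl measurableT L (integrable_affine3 (- P y) (- y) (y * P y) iIP iI iP).
    by apply: eq_integrable => // x _.
  - by move=> x _; exact: key.
(* the same inequality, arranged for integration in the second variable *)
have key3 y : H y * f y + (- a) * f y + (- b) * H y + A <=
    L * (y * P y + (- c) * y + 0 * y + S).
  by have := key2 y; rewrite -/a -/b; nra.
have := @le_Rintegral _ _ _ gam setT
   (fun y => H y * f y + (- a) * f y + (- b) * H y + A)
   (fun y => L * (y * P y + (- c) * y + 0 * y + S)) measurableT.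
rewrite Rintegral_affine3// RintegralZl//; last exact: integrable_affine3.
rewrite Rintegral_affine3// SE Rintegral_id_std_normal -/a -/b -/A => h.
have {h} : A + - a * b + - b * a + A <= L * (S + - c * 0 + 0 * 0 + S).
  apply: h => //.
  - exact: integrable_affine3.
  - have := integrableZl measurableT L (integrable_affine3 (- c) 0 S iIP iI iI).
    by apply: eq_integrable => // x _.
by rewrite mulr0 mul0r !addr0 mulrDr; lra.
Qed.

End Cov.

(** * Resampling one coordinate of a Gaussian vector *)

Section Resample.
Context {R : realType}.
Local Notation RR := (measurableTypeR R).
Local Notation gam := (normal_prob (0 : R) 1).

(** Replaces the [j]-th coordinate.  With a fresh Gaussian value it preserves the
    standard Gaussian law, which turns statements about one coordinate into
    one-dimensional ones. *)
Definition resample d (t : d.-tuple RR) (j : 'I_d) (x : RR) : d.-tuple RR :=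
  [tuple (if i == j then x else tnth t i) | i < d].

Lemma tnth_resample d (t : d.-tuple RR) j x i :
  tnth (resample t j x) i = if i == j then x else tnth t i.
Proof. by rewrite tnth_mktuple. Qed.

Lemma measurable_resample d (j : 'I_d) :
  measurable_fun [set: d.-tuple RR * RR]
    (fun z : d.-tuple RR * RR => resample z.1 j z.2).
Proof.
apply/measurable_fun_tnthP => i /=.
have [->|ij] := eqVneq i j.
  rewrite (_ : _ \o _ = snd) //; apply/funext => z /=.
  by rewrite tnth_resample eqxx.
rewrite (_ : _ \o _ = (fun t => tnth t i) \o fst); last first.
  by apply/funext => z /=; rewrite tnth_resample (negPf ij).
by apply: measurableT_comp => //; exact: measurable_tnth.
Qed.

Lemma measurable_resample_at d (j : 'I_d) t :
  measurable_fun [set: RR] (fun x => resample t j x).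
Proof. exact: (measurableT_comp (measurable_resample j) (pair1_measurable t)). Qed.

Lemma ge0_integral_std_gaussianS m (f : m.+1.-tuple RR -> \bar R) :
  measurable_fun [set: m.+1.-tuple RR] f -> (forall t, 0 <= f t)%E ->
  (\int[std_gaussian m.+1]_t f t =
   \int[gam]_x \int[std_gaussian m]_t f (tuple_cons (x, t)))%E.
Proof.
move=> mf f0.
transitivity (\int[distribution (gam \x std_gaussian m)%E (@tuple_cons R m)]_t f t)%E.
  by [].
have mcons : measurable_fun [set: RR * m.-tuple RR] (fun z => f (tuple_cons z)).
  by apply: measurableT_comp => //; exact: measurable_tuple_cons.
rewrite ge0_integral_distribution//.
by rewrite (fubini_tonelli1 (m1 := gam) (m2 := std_gaussian m) _ mcons).
Qed.

Lemma tuple_cons_resample0 m (t : m.-tuple RR) x y :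
  resample (tuple_cons (y, t)) ord0 x = tuple_cons (x, t).
Proof.
apply: eq_from_tnth => i; rewrite tnth_resample.
by case: (unliftP ord0 i) => [j ->|->]; rewrite ?tnthS ?tnth0// eqxx.
Qed.

Lemma tuple_cons_resampleS m (t : m.-tuple RR) j x y :
  resample (tuple_cons (y, t)) (lift ord0 j) x = tuple_cons (y, resample t j x).
Proof.
apply: eq_from_tnth => i; rewrite tnth_resample.
case: (unliftP ord0 i) => [k ->|->]; last by rewrite !tnth0.
by rewrite !tnthS tnth_resample (inj_eq lift_inj).
Qed.

(** Invariance of the Gaussian law under resampling of one coordinate.  Induction
    on the dimension: the first coordinate is resampled by Fubini, the others by
    the induction hypothesis applied for each value of the first one. *)
Lemma ge0_integral_resample d (j : 'I_d) (f : d.-tuple RR -> \bar R) :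
  measurable_fun [set: d.-tuple RR] f -> (forall t, 0 <= f t)%E ->
  (\int[std_gaussian d]_t \int[gam]_x f (resample t j x) =
   \int[std_gaussian d]_t f t)%E.
Proof.
elim: d j f => [[]//|m IH] j f mf f0.
have mcons : measurable_fun [set: RR * m.-tuple RR] (fun z => f (tuple_cons z)).
  by apply: measurableT_comp => //; exact: measurable_tuple_cons.
rewrite ge0_integral_std_gaussianS; last 2 first.
- apply: (@measurable_fun_fubini_tonelli_F _ _ _ _ _ gam
    (fun z : m.+1.-tuple RR * RR => f (resample z.1 j z.2))) => //.
  by apply: measurableT_comp => //; exact: measurable_resample.
- by move=> t; exact: integral_ge0.
rewrite (ge0_integral_std_gaussianS mf f0).
case: (unliftP ord0 j) => [k ->|->].
  apply: eq_integral => y _.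
  have my := measurableT_comp mcons (pair1_measurable y).
  apply: etrans (IH k _ my (fun t => f0 (tuple_cons (y, t)))).
  by apply: eq_integral => t _; apply: eq_integral => x _; rewrite tuple_cons_resampleS.
under eq_integral do under eq_integral do under eq_integral do rewrite tuple_cons_resample0.
rewrite integral_cst//= [X in (_ * X)%E]probability_setT mule1.
by rewrite (fubini_tonelli (m1 := gam) (m2 := std_gaussian m) _ mcons).
Qed.

End Resample.

Section Resample2.
Context {R : realType}.
Local Notation RR := (measurableTypeR R).
Local Notation gam := (normal_prob (0 : R) 1).
Variable d : nat.
Implicit Types (t : d.-tuple RR) (j : 'I_d) (f : d.-tuple RR -> R).

Lemma integrable_resample j f :
  (std_gaussian d).-integrable setT (EFin \o f) ->
  (std_gaussian d \x gam)%E.-integrable setT (fun z => (f (resample z.1 j z.2))%:E).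
Proof.
move=> /integrableP[mf fi]; apply/integrableP; split.
  exact: (measurableT_comp mf (measurable_resample j)).
have mfa : measurable_fun [set: d.-tuple RR] (fun t => `|(f t)%:E|)%E.
  exact: measurableT_comp.
have mfj := measurableT_comp mfa (measurable_resample j).
rewrite (fubini_tonelli1 (m1 := std_gaussian d) (m2 := gam) _ mfj); last by move=> z /=.
by rewrite /fubini_F/= (ge0_integral_resample j mfa).
Qed.

Lemma integral_resample j f :
  (std_gaussian d).-integrable setT (EFin \o f) ->
  (\int[std_gaussian d]_t \int[gam]_x (f (resample t j x))%:E =
   \int[std_gaussian d]_t (f t)%:E)%E.
Proof.
move=> fi; have ifj := integrable_resample j fi.
have := integral12_prod_meas1 ifj; rewrite /fubini_F/= => ->.
have mf := measurable_int _ fi.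
rewrite integralE [RHS]integralE.
congr (_ - _)%E.
- rewrite -(ge0_integral_resample j (measurable_funepos mf))//.
  have mj := measurableT_comp (measurable_funepos mf) (measurable_resample j).
  transitivity (\int[(std_gaussian d \x gam)%E]_z ((EFin \o f)^\+ (resample z.1 j z.2)))%E.
    by apply: eq_integral => z _; rewrite !funeposE.
  by rewrite (fubini_tonelli1 (m1 := std_gaussian d) (m2 := gam) _ mj)// => z /=.
- rewrite -(ge0_integral_resample j (measurable_funeneg mf))//.
  have mj := measurableT_comp (measurable_funeneg mf) (measurable_resample j).
  transitivity (\int[(std_gaussian d \x gam)%E]_z ((EFin \o f)^\- (resample z.1 j z.2)))%E.
    by apply: eq_integral => z _; rewrite !funenegE.
  by rewrite (fubini_tonelli1 (m1 := std_gaussian d) (m2 := gam) _ mj)// => z /=.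
Qed.

Lemma Rintegral_resample j f :
  (std_gaussian d).-integrable setT (EFin \o f) ->
  (forall t, gam.-integrable setT (EFin \o (fun x => f (resample t j x)))) ->
  (std_gaussian d).-integrable setT (EFin \o (fun t => \int[gam]_x f (resample t j x))) /\
  \int[std_gaussian d]_t \int[gam]_x f (resample t j x) = \int[std_gaussian d]_t f t.
Proof.
move=> fi fj.
have E t : (\int[gam]_x f (resample t j x))%:E = (\int[gam]_x (f (resample t j x))%:E)%E.
  by rewrite /Rintegral fineK//; exact: (integrable_fin_num measurableT (fj t)).
split.
  have := integrable_fubini_F (integrable_resample j fi); apply: eq_integrable => //.
  by move=> t _; rewrite [RHS]/= E.
rewrite [LHS]/Rintegral [RHS]/Rintegral -(integral_resample j fi).
by congr fine; apply: eq_integral => t _.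
Qed.

Lemma integral_std_gaussian_coord j (h : R -> R) :
  measurable_fun [set: RR] h -> (forall x, 0 <= h x) ->
  (\int[std_gaussian d]_t (h (tnth t j))%:E = \int[gam]_x (h x)%:E)%E.
Proof.
move=> mh h0.
have mhj : measurable_fun [set: d.-tuple RR] (fun t => (h (tnth t j))%:E).
  apply/measurable_EFinP; apply: (measurableT_comp mh); exact: measurable_tnth.
rewrite -(ge0_integral_resample j mhj); last by move=> t; rewrite lee_fin.
transitivity (\int[std_gaussian d]_t (cst (\int[gam]_x (h x)%:E) t))%E.
  apply: eq_integral => t _; apply: eq_integral => x _.
  by rewrite tnth_resample eqxx.
by rewrite integral_cst// [X in (_ * X)%E]probability_setT mule1.
Qed.

(** A sufficient condition for integrability that is stable under freezing all
    coordinates but one. *)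
Definition sqr_growth (f : d.-tuple RR -> R) : Prop :=
  measurable_fun [set: d.-tuple RR] f /\
  exists C, forall t, `|f t| <= C * (1 + \sum_(i < d) tnth t i ^+ 2).

Lemma sqr_growth_integrable f : sqr_growth f ->
  (std_gaussian d).-integrable setT (EFin \o f).
Proof.
move=> [mf [C fC]].
have i1 : (std_gaussian d).-integrable setT (EFin \o (fun=> 1 : R)).
  exact: finite_measure_integrable_cst.
have i2 i : (std_gaussian d).-integrable setT (fun t => ((tnth t i : R) ^+ 2)%:E).
  apply/integrableP; split.
    by apply/measurable_EFinP; apply: measurable_funX; exact: measurable_tnth.
  under eq_integral do rewrite /= ger0_norm ?sqr_ge0//.
  rewrite (@integral_std_gaussian_coord i (fun x => x ^+ 2)) ?integral_sqr_std_normal ?ltry//.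
  by move=> x; exact: sqr_ge0.
have i3 : (std_gaussian d).-integrable setT
    (fun t => \sum_(i < d) ((tnth t i : R) ^+ 2)%:E)%E.
  exact: integrable_sum.
have := integrableZl measurableT C (integrableD measurableT i1 i3).
apply: le_integrable => //; first exact/measurable_EFinP.
move=> t _ /=; rewrite sumEFin -EFinD -EFinM/= lee_fin (le_trans (fC t))//.
exact: ler_norm.
Qed.

Lemma sqr_growth_resample f j t : sqr_growth f ->
  gam.-integrable setT (EFin \o (fun x => f (resample t j x))).
Proof.
move=> [mf [C fC]].
apply: (@std_normal_integrable _ _ (`|C| * (1 + \sum_(i < d) tnth t i ^+ 2))).
  exact: (measurableT_comp mf (measurable_resample_at j t)).
move=> x; apply: (le_trans (fC _)).
apply: (@le_trans _ _ (`|C| * (1 + \sum_(i < d) tnth (resample t j x) i ^+ 2))).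
  by rewrite ler_wpM2r ?ler_norm// addr_ge0// sumr_ge0// => i _; exact: sqr_ge0.
rewrite -mulrA ler_wpM2l//.
have h : \sum_(i < d) tnth (resample t j x) i ^+ 2 <= \sum_(i < d) tnth t i ^+ 2 + x ^+ 2.
  rewrite (bigD1 j)//= tnth_resample eqxx [X in _ <= X + _](bigD1 j)//=.
  rewrite addrC lerD2r; apply: ler_wpDl; first exact: sqr_ge0.
  rewrite le_eqVlt; apply/orP; left; apply/eqP; apply: eq_bigr => i ij.
  by rewrite tnth_resample (negPf ij).
have : 0 <= \sum_(i < d) (tnth t i : R) ^+ 2 by apply: sumr_ge0 => i _; exact: sqr_ge0.
have := sqr_ge0 x; nra.
Qed.

Lemma lipschitz_mul_sqr_growth j (H : R -> R) (F : d.-tuple RR -> R) (L C : R) :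
  (forall x y, `|H x - H y| <= L * `|x - y|) -> measurable_fun [set: RR] H ->
  measurable_fun [set: d.-tuple RR] F ->
  (forall t, F t ^+ 2 <= C * (1 + \sum_(i < d) tnth t i ^+ 2)) ->
  sqr_growth (fun t => H (tnth t j) * F t).
Proof.
move=> HL mH mF FC.
split.
  apply: measurable_funM => //.
  by apply: (measurableT_comp mH); exact: measurable_tnth.
exists (2 * (`|H 0| + L) ^+ 2 + C) => t; rewrite normrM.
have h1 := lipschitz_growth HL (tnth t j).
have L0 : 0 <= L by have := HL 1 0; rewrite subr0 normr1 mulr1; exact: le_trans.
set K := `|H 0| + L in h1 *; have K0 : 0 <= K by rewrite addr_ge0.
have h2 : `|H (tnth t j)| ^+ 2 <= 2 * K ^+ 2 * (1 + tnth t j ^+ 2).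
  rewrite -[tnth t j ^+ 2]real_normK ?num_real//.
  apply: (@le_trans _ _ ((K * (1 + `|tnth t j : R|)) ^+ 2)).
    by rewrite ler_sqr ?nnegrE// mulr_ge0.
  set z := `|_|; have hz := sqr_ge0 (1 - z); have hK := sqr_ge0 K.
  have -> : (K * (1 + z)) ^+ 2 = K ^+ 2 * (1 + z) ^+ 2 by ring.
  have -> : 2 * K ^+ 2 * (1 + z ^+ 2) = K ^+ 2 * (2 * (1 + z ^+ 2)) by ring.
  by rewrite ler_wpM2l//; nra.
have h3 : (tnth t j : R) ^+ 2 <= \sum_(i < d) (tnth t i : R) ^+ 2.
  by rewrite (bigD1 j)//= lerDl sumr_ge0// => i _; exact: sqr_ge0.
have h4 := FC t; rewrite -[F t ^+ 2]real_normK ?num_real// in h4.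
have h5 : `|H (tnth t j)| * `|F t| <= `|H (tnth t j)| ^+ 2 + `|F t| ^+ 2.
  have := sqr_ge0 (`|H (tnth t j)| - `|F t|); have := sqr_ge0 (`|H (tnth t j)|).
  have := sqr_ge0 (`|F t|); nra.
rewrite mulrDl (le_trans h5)// lerD// (le_trans h2)// ler_wpM2l ?lerD2l//.
by rewrite mulr_ge0// sqr_ge0.
Qed.

(** The one-dimensional covariance inequality in the [j]-th coordinate, the other
    coordinates being frozen, then integrated over them.  The term that
    multiplies the mean of [H] is linear, hence recombines into the full
    expectation of [F]. *)
Lemma std_gaussian_covariance_le j (H : R -> R) (F P : d.-tuple RR -> R) (L M C : R) :
  (forall x y, `|H x - H y| <= L * `|x - y|) -> measurable_fun [set: RR] H ->
  measurable_fun [set: d.-tuple RR] F -> measurable_fun [set: d.-tuple RR] P ->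
  (forall t, F t ^+ 2 <= C * (1 + \sum_(i < d) tnth t i ^+ 2)) ->
  (forall t, 0 <= P t) -> (forall t, P t <= M) ->
  (forall t x y, x <= y -> `|F (resample t j y) - F (resample t j x)| <=
     primitive (fun z => P (resample t j z)) y - primitive (fun z => P (resample t j z)) x) ->
  \int[std_gaussian d]_t (H (tnth t j) * F t) <=
  (\int[gam]_x H x) * (\int[std_gaussian d]_t F t) + L * \int[std_gaussian d]_t P t.
Proof.
move=> HL mH mF mP FC P0 PM hF.
have sum0 t : 0 <= \sum_(i < d) (tnth t i : R) ^+ 2.
  by apply: sumr_ge0 => i _; exact: sqr_ge0.
have gF : sqr_growth F.
  split => //; exists (1 + C) => t.
  by have := FC t; have := sum0 t; have := normr_le_1Dsqr (F t); nra.
have gP : sqr_growth P.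
  split => //; exists M => t; rewrite ger0_norm// (le_trans (PM t))//.
  rewrite ler_peMr ?lerDl//; exact: le_trans (P0 t) (PM t).
have gHF := lipschitz_mul_sqr_growth j HL mH mF FC.
have sF t := sqr_growth_resample j t gF.
have sP t := sqr_growth_resample j t gP.
have sHF t := sqr_growth_resample j t gHF.
have [iF EF] := Rintegral_resample (sqr_growth_integrable gF) sF.
have [iP EP] := Rintegral_resample (sqr_growth_integrable gP) sP.
have [iHF EHF] := Rintegral_resample (sqr_growth_integrable gHF) sHF.
rewrite -EF -EP -EHF -RintegralZl// -RintegralZl// -RintegralD//; last 2 first.
- have := integrableZl measurableT (\int[gam]_x H x) iF.
  by apply: eq_integrable.
- have := integrableZl measurableT L iP.
  by apply: eq_integrable.
apply: le_Rintegral => //.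
  have := integrableD measurableT (integrableZl measurableT (\int[gam]_x H x) iF)
    (integrableZl measurableT L iP).
  by apply: eq_integrable.
move=> t _.
rewrite (@eq_Rintegral _ _ _ gam _ (fun x => H x * F (resample t j x))); last first.
  by move=> x _; rewrite tnth_resample eqxx.
apply: (gaussian_covariance_le (M := M)) => //.
- exact: (measurableT_comp mF (measurable_resample_at j t)).
- exact: (measurableT_comp mP (measurable_resample_at j t)).
- exact: hF.
Qed.

End Resample2.

(** * Distance to a multiple of the subdifferential *)

Section Profile.
Context {R : realType} {d : nat}.
Variables (T : {set 'I_d}) (w : 'I_d -> R).
Hypothesis w0 : forall j, 0 <= w j.
Implicit Types (y : 'I_d -> R) (s t r : R).

(** For [t >= 0], the distance from [x] to the [j]-th factor of [t] times the
    subdifferential of the weighted norm, with a sign on the support: the factor is the point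
    [t * w j] on the support [T] and the interval [[- t * w j, t * w j]] off it.
    On the support [x] is the entry multiplied by the sign of [x0], off the
    support it is the absolute value of the entry.  Letting [x] and [t] range
    over the whole line keeps the functions below monotone without side
    conditions. *)
Definition residual (j : 'I_d) (x t : R) : R :=
  if j \in T then x - t * w j else Num.max (x - t * w j) 0.

(** Minus half the derivative in [t] of [residual_dist]. *)
Definition residual_slope y t : R := \sum_j w j * residual j (y j) t.

(** The squared distance to [t] times the subdifferential. *)
Definition residual_dist y t : R := \sum_j residual j (y j) t ^+ 2.

Definition active j (x t : R) : bool := (j \in T) || (t * w j < x).

(** Half the second derivative in [t] of [residual_dist], away from the kinks. *)
Definition curvature y t : R := \sum_j w j ^+ 2 * (active j (y j) t)%:R.

Definition support_curvature : R := \sum_(j in T) w j ^+ 2.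

Let maxP (x : R) : (x <= 0 /\ Num.max x 0 = 0) \/ (0 < x /\ Num.max x 0 = x).
Proof.
by have [h|h] := leP x 0; [left|right].
Qed.

Lemma residual_tangent j x t r :
  residual j x t * (residual j x t - residual j x r) <= residual j x t * (w j * (r - t)).
Proof.
rewrite /residual; case: ifP => _; first by rewrite le_eqVlt; apply/orP; left; apply/eqP; ring.
have := maxP (x - t * w j); have := maxP (x - r * w j).
by move=> [[h1 ->]|[h1 ->]] [[h2 ->]|[h2 ->]]; nra.
Qed.

(** The tangent inequality for the convex function [residual_dist y]. *)
Lemma residual_dist_tangent y t r :
  residual_dist y t - residual_dist y r <= 2 * (r - t) * residual_slope y t.
Proof.
rewrite /residual_dist /residual_slope -sumrB mulr_sumr; apply: ler_sum => j _.
have := residual_tangent j (y j) t r.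
have := sqr_ge0 (residual j (y j) t - residual j (y j) r); nra.
Qed.

Lemma residual_decreasing j x s t : s <= t ->
  w j * (active j x t)%:R * (t - s) <= residual j x s - residual j x t.
Proof.
move=> st; rewrite /residual /active; have := w0 j; case: ifP => _ /=.
  by rewrite mulr1 => _; rewrite le_eqVlt; apply/orP; left; apply/eqP; ring.
move=> wj; have hst : s * w j <= t * w j by rewrite ler_wpM2r.
have [|] := ltP (t * w j) x => h; rewrite /= ?mulr1 ?mulr0 ?mul0r;
  have := maxP (x - t * w j); have := maxP (x - s * w j);
by move=> [[h1 ->]|[h1 ->]] [[h2 ->]|[h2 ->]]; lra.
Qed.

Lemma residual_homo j x x' t : x <= x' ->
  0 <= residual j x' t - residual j x t <= x' - x.
Proof.
move=> xx; rewrite /residual; case: ifP => _.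
  by apply/andP; split; lra.
have := maxP (x - t * w j); have := maxP (x' - t * w j).
by move=> [[h1 ->]|[h1 ->]] [[h2 ->]|[h2 ->]]; apply/andP; split; lra.
Qed.

Lemma residual_inactive j x t : ~~ active j x t -> residual j x t = 0.
Proof.
rewrite /residual /active negb_or -leNgt => /andP[/negPf-> h].
by apply/max_idPr; lra.
Qed.

Lemma curvature_ge y t : support_curvature <= curvature y t.
Proof.
rewrite /support_curvature /curvature [leLHS]big_mkcond/=; apply: ler_sum => j _.
rewrite /active; case: ifP => _ /=; first by rewrite mulr1.
by rewrite mulr_ge0// sqr_ge0.
Qed.

(** The curvature at the right end point bounds the decrease from below because
    coordinates only become inactive as [t] grows. *)
Lemma residual_slope_decreasing y s t : s <= t ->
  curvature y t * (t - s) <= residual_slope y s - residual_slope y t.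
Proof.
move=> st; rewrite /residual_slope /curvature -sumrB mulr_suml; apply: ler_sum => j _.
rewrite -mulrBr expr2 -!mulrA ler_wpM2l// mulrA; exact: residual_decreasing.
Qed.

Lemma continuous_residual_slope y : continuous (residual_slope y).
Proof.
move=> t; rewrite /residual_slope.
apply: cvg_big => [|i _]; first exact: add_continuous.
apply: cvgM; first exact: cvg_cst.
have h : y i - s * w i @[s --> t] --> y i - t * w i.
  by apply: cvgB; [exact: cvg_cst|apply: cvgM; [exact: cvg_id|exact: cvg_cst]].
rewrite /residual; case: ifP => _ //.
by apply: (@continuous_max _ _ (fun s => y i - s * w i) (fun=> 0)); [exact: h|exact: cvg_cst].
Qed.

Hypothesis WT0 : 0 < support_curvature.

Lemma residual_slope_root_ex y : exists r, residual_slope y r = 0.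
Proof.
(* the slope changes by at least |slope at 0| over this length *)
pose M := `|residual_slope y 0| / support_curvature.
have M0 : 0 <= M by rewrite divr_ge0// ltW.
have WM : support_curvature * M = `|residual_slope y 0|.
  by rewrite mulrC divfK// gt_eqF.
have h1 : residual_slope y M <= 0.
  have := residual_slope_decreasing y M0; rewrite subr0.
  have := curvature_ge y M; have := ler_norm (residual_slope y 0); nra.
have h2 : 0 <= residual_slope y (- M).
  have NM0 : - M <= 0 by rewrite oppr_le0.
  have := residual_slope_decreasing y NM0; rewrite sub0r opprK.
  have := curvature_ge y 0; have := ler_norm (- residual_slope y 0).
  rewrite normrN; nra.
have MM : - M <= M by rewrite (le_trans _ M0)// oppr_le0.
have := @IVT R (residual_slope y) (- M) M 0 MM.
case.
- by apply: continuous_subspaceT; exact: continuous_residual_slope.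
- by rewrite ge_min h1 orbT le_max h2.
- by move=> c _ hc; exists c.
Qed.

(** The minimizer of [residual_dist y] over the whole line. *)
Definition root_slope y : R := xget 0 [set r | residual_slope y r = 0].

Lemma root_slopeP y : residual_slope y (root_slope y) = 0.
Proof.
rewrite /root_slope; case: xgetP => //= h.
by have [r hr] := residual_slope_root_ex y; have := h r hr.
Qed.

Lemma residual_slope_anti y s t : s < t -> residual_slope y t < residual_slope y s.
Proof.
move=> st; rewrite -subr_gt0; apply: lt_le_trans (residual_slope_decreasing y (ltW st)).
by rewrite mulr_gt0 ?subr_gt0// (lt_le_trans WT0)// curvature_ge.
Qed.

Lemma root_slope_le y c : (root_slope y <= c) = (residual_slope y c <= 0).
Proof.
apply/idP/idP => h; last first.
  rewrite leNgt; apply/negP => /(residual_slope_anti y); rewrite root_slopeP.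
  by move=> h2; have := lt_le_trans h2 h; rewrite ltxx.
move: h; rewrite le_eqVlt => /predU1P[<-|]; first by rewrite root_slopeP.
by move/(residual_slope_anti y)/ltW; rewrite root_slopeP.
Qed.

(** The slope decreases at a rate at least [support_curvature], which keeps its
    root close to the origin. *)
Lemma root_slope_bound y : `|root_slope y| * support_curvature <= `|residual_slope y 0|.
Proof.
have WC t := curvature_ge y t.
have [r0|r0] := leP 0 (root_slope y).
  have := residual_slope_decreasing y r0; rewrite root_slopeP !subr0.
  have := WC (root_slope y); have := ler_norm (residual_slope y 0).
  by rewrite [`|root_slope y|]ger0_norm//; nra.
have := residual_slope_decreasing y (ltW r0); rewrite root_slopeP !sub0r.
have := WC 0; have := ler_norm (- residual_slope y 0); rewrite normrN.
by rewrite [`|root_slope y|]ltr0_norm//; nra.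
Qed.

(** The derivative of the minimizer in the [j]-th coordinate, by the implicit
    function theorem. *)
Definition sensitivity j y : R :=
  w j * (active j (y j) (root_slope y))%:R / curvature y (root_slope y).

Lemma sensitivity_ge0 j y : 0 <= sensitivity j y.
Proof.
by rewrite divr_ge0// ?mulr_ge0// ltW// (lt_le_trans WT0)// curvature_ge.
Qed.

Lemma sensitivity_le j y : sensitivity j y <= w j / support_curvature.
Proof.
have h := curvature_ge y (root_slope y).
have c0 : 0 < curvature y (root_slope y) by exact: lt_le_trans h.
rewrite /sensitivity ler_pM// ?mulr_ge0 ?invr_ge0 ?(ltW c0)//.
  by case: (active _ _ _); rewrite ?mulr1// mulr0.
by rewrite lef_pV2.
Qed.

(** The weighted sensitivities add up to one because the curvature is the sum of
    the squared weights of the active coordinates.  This is what makes the final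
    error independent of the weights. *)
Lemma sum_sensitivity y : \sum_j w j * sensitivity j y = 1.
Proof.
have c0 : 0 < curvature y (root_slope y) by exact: lt_le_trans (curvature_ge _ _).
rewrite /sensitivity; under eq_bigr do rewrite !mulrA -expr2.
by rewrite -mulr_suml divff// gt_eqF.
Qed.

Definition set_coord y (j : 'I_d) (x : R) : 'I_d -> R := fun i => if i == j then x else y i.

Lemma residual_slope_set_coord y j x x' t :
  residual_slope (set_coord y j x') t - residual_slope (set_coord y j x) t =
  w j * (residual j x' t - residual j x t).
Proof.
rewrite /residual_slope -sumrB (bigD1 j)//= /set_coord !eqxx -mulrBr big1 ?addr0//.
by move=> i /negPf->; rewrite subrr.
Qed.

Lemma root_slope_homo y j x x' : x <= x' ->
  root_slope (set_coord y j x) <= root_slope (set_coord y j x').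
Proof.
move=> xx; rewrite root_slope_le.
set r' := root_slope _.
have := residual_slope_set_coord y j x x' r'; rewrite root_slopeP sub0r => /eqP.
rewrite eqr_oppLR => /eqP ->; rewrite oppr_le0 mulr_ge0//.
by have /andP[] := residual_homo j r' xx.
Qed.

(** A coordinate that is inactive at its larger value is inactive at the smaller
    one too, so it enters neither equation. *)
Lemma root_slope_inactive y j x x' : x <= x' ->
  ~~ active j x' (root_slope (set_coord y j x')) ->
  root_slope (set_coord y j x) = root_slope (set_coord y j x').
Proof.
move=> xx na; apply/eqP; rewrite eq_le root_slope_homo//=.
set r := root_slope (set_coord y j x).
set r' := root_slope (set_coord y j x') in na *.
rewrite leNgt; apply/negP => /(residual_slope_anti (set_coord y j x)).
rewrite root_slopeP => h.
have := residual_slope_set_coord y j x x' r'; rewrite root_slopeP (residual_inactive na).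
rewrite (@residual_inactive j x); first by rewrite subrr mulr0 sub0r; lra.
move: na; rewrite /active !negb_or -!leNgt => /andP[-> h2] /=; exact: le_trans xx h2.
Qed.

(** The slope gains at most [w j * (x' - x)] when the coordinate grows, and has to
    lose this gain at a rate that is at least the curvature at the new root. *)
Lemma root_slope_increment y j x x' : x <= x' ->
  root_slope (set_coord y j x') - root_slope (set_coord y j x) <=
  (x' - x) * sensitivity j (set_coord y j x').
Proof.
move=> xx; set y' := set_coord y j x'; set r' := root_slope y'.
have c0 : 0 < curvature y' r' by exact: lt_le_trans (curvature_ge _ _).
have y'j : y' j = x' by rewrite /y' /set_coord eqxx.
rewrite /sensitivity -/r' y'j mulrA ler_pdivlMr//.
have [act|na] := boolP (active j x' r'); last first.
  by rewrite (root_slope_inactive xx na) subrr mul0r mulr0 mulr0.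
rewrite mulr1 mulrC [_ * w j]mulrC.
apply: le_trans (residual_slope_decreasing y' (root_slope_homo y j xx)) _.
rewrite root_slopeP subr0.
have := residual_slope_set_coord y j x x' (root_slope (set_coord y j x)).
rewrite root_slopeP subr0 => ->; rewrite ler_wpM2l//.
by have /andP[] := residual_homo j (root_slope (set_coord y j x)) xx.
Qed.

(** The minimizer is a convex function of each coordinate: raising one coordinate
    raises the root, which can only deactivate the other coordinates and lower
    the curvature. *)
Lemma sensitivity_homo y j x x' : x <= x' ->
  sensitivity j (set_coord y j x) <= sensitivity j (set_coord y j x').
Proof.
move=> xx; set y1 := set_coord y j x; set y2 := set_coord y j x'.
have y1j : y1 j = x by rewrite /y1 /set_coord eqxx.
have y2j : y2 j = x' by rewrite /y2 /set_coord eqxx.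
have [a1|na1] := boolP (active j (y1 j) (root_slope y1)); last first.
  by rewrite [leLHS]/sensitivity (negPf na1) mulr0 mul0r sensitivity_ge0.
have r12 : root_slope y1 <= root_slope y2 by exact: root_slope_homo.
have a2 : active j (y2 j) (root_slope y2).
  rewrite y2j; apply/negPn/negP => na2; have := root_slope_inactive xx na2.
  rewrite -/y1 -/y2 => r12E; move: na2 a1; rewrite -r12E y1j /active negb_or -leNgt.
  by move=> /andP[/negPf-> h2] /= h1; have := lt_le_trans h1 (le_trans xx h2); rewrite ltxx.
rewrite /sensitivity a1 a2 !mulr1 ler_wpM2l// lef_pV2 ?posrE ?(lt_le_trans WT0) ?curvature_ge//.
apply: ler_sum => i _; rewrite ler_wpM2l ?sqr_ge0//.
have [->|ij] := eqVneq i j; first by rewrite a1 a2.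
have -> : y2 i = y1 i by rewrite /y2 /y1 /set_coord (negPf ij).
rewrite /active; case: (i \in T) => //=; rewrite ler_nat.
case: ltP => //= h; rewrite (le_lt_trans _ h)// ler_wpM2r//.
Qed.

End Profile.

(** * The optimal multiple of a Gaussian vector *)

(** Cauchy-Schwarz against the constant vector. *)
Lemma sqr_sum_le (R : realType) (I : finType) (b : I -> R) :
  (\sum_i b i) ^+ 2 <= #|I|%:R * \sum_i b i ^+ 2.
Proof.
rewrite expr2 mulr_suml.
apply: (@le_trans _ _ (\sum_i \sum_j (b i ^+ 2 / 2 + b j ^+ 2 / 2))).
  apply: ler_sum => i _; rewrite mulr_sumr; apply: ler_sum => j _.
  by have := sqr_ge0 (b i - b j); nra.
under eq_bigr do rewrite big_split/= sumr_const -mulr_suml.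
rewrite big_split/= sumr_const sumrMnl -mulr_suml; set S := \sum_i _.
by rewrite -[X in X + _]mulr_natl -[X in _ + X]mulr_natl; lra.
Qed.

Lemma Rintegral_sum d (X : measurableType d) (R : realType)
    (mu : {measure set X -> \bar R}) (I : Type) (r : seq I) (f : I -> X -> R) :
  (forall i, mu.-integrable setT (EFin \o f i)) ->
  \int[mu]_x (\sum_(i <- r) f i x) = \sum_(i <- r) \int[mu]_x f i x.
Proof.
move=> fi; elim: r => [|i r IH].
  rewrite big_nil; under eq_Rintegral do rewrite big_nil.
  by rewrite /Rintegral integral0.
rewrite big_cons -IH -RintegralD//; first by under eq_Rintegral do rewrite big_cons.
have := @integrable_sum _ _ _ mu setT measurableT _ r xpredT
  (fun i => EFin \o f i) (fun i _ => fi i).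
by apply: eq_integrable => // x _; rewrite /= -sumEFin.
Qed.

Section Gaussian.
Context {R : realType} {d : nat}.
Local Notation RR := (measurableTypeR R).
Local Notation gam := (normal_prob (0 : R) 1).
Local Notation gauss := (@std_gaussian R d).
Variables (T : {set 'I_d}) (w : 'I_d -> R) (e : 'I_d -> R).
Hypothesis w0 : forall j, 0 <= w j.
Hypothesis e1 : forall j, e j = 1 \/ e j = -1.
Implicit Types (t : d.-tuple RR) (j : 'I_d).

Definition aligned j (x : R) : R := if j \in T then e j * x else `|x|.

Definition profile t : 'I_d -> R := fun j => aligned j (tnth t j).

Lemma profile_resample t j x :
  profile (resample t j x) = set_coord (profile t) j (aligned j x).
Proof.
apply/funext => i; rewrite /profile /set_coord tnth_resample.
by case: eqVneq => // ->.
Qed.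

Lemma normr_aligned j x : `|aligned j x| = `|x|.
Proof.
rewrite /aligned; case: ifP => _; last by rewrite normr_id.
by rewrite normrM; case: (e1 j) => ->; rewrite ?normrN normr1 mul1r.
Qed.

Lemma aligned_lipschitz j x x' : `|aligned j x - aligned j x'| <= `|x - x'|.
Proof.
rewrite /aligned; case: ifP => _; last exact: ler_dist_dist.
by rewrite -mulrBr normrM; case: (e1 j) => ->; rewrite ?normrN normr1 mul1r.
Qed.

Lemma measurable_aligned j : measurable_fun [set: RR] (aligned j).
Proof.
rewrite /aligned; case: (j \in T); last exact: normr_measurable.
by apply: measurable_funM.
Qed.

Lemma measurable_profile j : measurable_fun [set: d.-tuple RR] (fun t => profile t j).
Proof. exact: (measurableT_comp (measurable_aligned j) (measurable_tnth j)). Qed.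

Lemma measurable_residual d' (X : measurableType d') j (f g : X -> R) :
  measurable_fun [set: X] f -> measurable_fun [set: X] g ->
  measurable_fun [set: X] (fun x => residual T w j (f x) (g x)).
Proof.
move=> mf mg; rewrite /residual.
have m1 : measurable_fun [set: X] (fun x => f x - g x * w j).
  by apply: measurable_funB => //; exact: measurable_funM.
by case: (j \in T) => //; exact: measurable_maxr.
Qed.

Lemma measurable_residual_slope c :
  measurable_fun [set: d.-tuple RR] (fun t => residual_slope T w (profile t) c).
Proof.
apply: measurable_sum => j; apply: measurable_funM => //.
by apply: measurable_residual => //; exact: measurable_profile.
Qed.

Lemma measurable_residual_dist (f : d.-tuple RR -> R) :
  measurable_fun [set: d.-tuple RR] f ->
  measurable_fun [set: d.-tuple RR] (fun t => residual_dist T w (profile t) (f t)).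
Proof.
move=> mf; apply: measurable_sum => j; apply: measurable_funX.
by apply: measurable_residual => //; exact: measurable_profile.
Qed.

Lemma residual_growth j x c : `|residual T w j (aligned j x) c| <= `|x| + `|c| * w j.
Proof.
rewrite -(normr_aligned j x).
have h : `|aligned j x - c * w j| <= `|aligned j x| + `|c| * w j.
  by rewrite (le_trans (ler_normB _ _))// normrM [`|w j|]ger0_norm.
rewrite /residual; case: ifP => _ //.
apply: le_trans h; rewrite maxC /Num.max; case: ifP => //.
by rewrite normr0.
Qed.

Lemma residual_dist_growth c : sqr_growth (fun t => residual_dist T w (profile t) c).
Proof.
split; first exact: measurable_residual_dist.
exists (2 + \sum_j 2 * (`|c| * w j) ^+ 2) => t.
rewrite ger0_norm; last by apply: sumr_ge0 => j _; exact: sqr_ge0.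
have S0 : 0 <= \sum_(i < d) (tnth t i : R) ^+ 2 by apply: sumr_ge0 => i _; exact: sqr_ge0.
have C0 : 0 <= \sum_j 2 * (`|c| * w j) ^+ 2.
  by apply: sumr_ge0 => j _; rewrite mulr_ge0// sqr_ge0.
apply: (@le_trans _ _
  (2 * \sum_(i < d) (tnth t i : R) ^+ 2 + \sum_j 2 * (`|c| * w j) ^+ 2)); last by nra.
rewrite mulr_sumr -big_split/=; apply: ler_sum => j _.
exact: ler_sqr_normD (residual_growth j (tnth t j) c).
Qed.

Hypothesis WT0 : 0 < support_curvature T w.
Local Notation root t := (root_slope T w (profile t)).

Lemma measurable_root : measurable_fun [set: d.-tuple RR] (fun t => root t).
Proof.
move=> mD; apply: (measurability _ (RGenOInfty.measurableE R)) => //.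
move=> /= _ [_ [x ->] <-]; apply: measurableI => //.
rewrite (_ : _ @^-1` _ = ~` [set t | residual_slope T w (profile t) x <= 0]); last first.
  apply/seteqP; split => t /=; rewrite in_itv/= andbT.
    by rewrite -(root_slope_le w0 WT0) ltNge => /negP.
  by rewrite -(root_slope_le w0 WT0) ltNge => /negP.
apply: measurableC.
rewrite (_ : mkset _ = setT `&` (fun t => residual_slope T w (profile t) x) @^-1` `]-oo, 0]).
  exact: measurable_residual_slope.
by apply/seteqP; split => t /=; rewrite in_itv/=; [move=> h|move=> []].
Qed.

Lemma sqr_root_le : exists C, forall t, root t ^+ 2 <= C * (1 + \sum_(i < d) (tnth t i : R) ^+ 2).
Proof.
pose W := \sum_i w i ^+ 2.
have W0 : 0 <= W by apply: sumr_ge0 => i _; exact: sqr_ge0.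
exists (d%:R * W / support_curvature T w ^+ 2) => t.
set S := \sum_(i < d) _.
have S0 : 0 <= S by apply: sumr_ge0 => i _; exact: sqr_ge0.
have h1 := root_slope_bound w0 WT0 (profile t).
have h2 : residual_slope T w (profile t) 0 ^+ 2 <= d%:R * W * S.
  apply: (le_trans (sqr_sum_le _)); rewrite card_ord -mulrA ler_wpM2l//.
  rewrite mulr_sumr; apply: ler_sum => j _; rewrite exprMn.
  apply: ler_pM; rewrite ?sqr_ge0//.
    by rewrite /W (bigD1 j)//= lerDl sumr_ge0// => i _; exact: sqr_ge0.
  have := residual_growth j (tnth t j) 0; rewrite normr0 mul0r addr0 => h.
  rewrite -[leLHS]real_normK ?num_real// -[leRHS]real_normK ?num_real//.
  by rewrite ler_sqr ?nnegrE.
rewrite mulrAC ler_pdivlMr ?exprn_gt0// -exprMn.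
apply: (@le_trans _ _ (d%:R * W * S)); last first.
  by rewrite ler_wpM2l ?mulr_ge0// lerDr.
apply: le_trans h2.
rewrite -[leLHS]real_normK ?num_real// -[leRHS]real_normK ?num_real//.
by rewrite ler_sqr ?nnegrE// normrM [X in _ * X]gtr0_norm.
Qed.

Lemma measurable_sensitivity j :
  measurable_fun [set: d.-tuple RR] (fun t => sensitivity T w j (profile t)).
Proof.
have mact i : measurable_fun [set: d.-tuple RR]
    (fun t => (active T w i (profile t i) (root t))%:R : R).
  apply: measurable_fun_natb; rewrite /active; case: (i \in T) => //=.
  apply: measurable_fun_ltr; last exact: measurable_profile.
  by apply: measurable_funM => //; exact: measurable_root.
have mcurv : measurable_fun [set: d.-tuple RR] (fun t => curvature T w (profile t) (root t)).
  by apply: measurable_sum => i; apply: measurable_funM.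
apply: measurable_funM; first exact: measurable_funM.
(* measurability of the inverse comes from that of real powers *)
rewrite (_ : (fun t => _) = fun t => curvature T w (profile t) (root t) `^ (-1)).
  exact: (measurableT_comp (measurable_powR (-1)) mcurv).
apply/funext => t; rewrite powR_inv1// (le_trans (ltW WT0))//; exact: curvature_ge.
Qed.

(** On each half-line [aligned j] is the identity or its opposite, so one of the
    two Riemann comparisons applies; the absolute value needs a cut at the
    origin. *)
Lemma aligned_slope_dominates (f p : R -> R) j (M : R) :
  measurable_fun [set: RR] (p \o aligned j) ->
  (forall x, 0 <= p x) -> (forall x, p x <= M) ->
  (forall x y, x <= y -> p x <= p y) ->
  (forall x y, x <= y -> `|f y - f x| <= (y - x) * p y) ->
  forall x y, x <= y ->
  `|f (aligned j y) - f (aligned j x)| <=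
   primitive (p \o aligned j) y - primitive (p \o aligned j) x.
Proof.
move=> mp p0 pM pm fp.
have PS x y m := @primitive_slope _ (p \o aligned j) M mp (fun z => p0 _) (fun z => pM _) x y m.
have up a b : a <= b -> (forall x, a <= x -> x <= b -> aligned j x = x) ->
    `|f (aligned j b) - f (aligned j a)| <=
    primitive (p \o aligned j) b - primitive (p \o aligned j) a.
  move=> ab E; apply: (@nondecreasing_slope_dominates _ (f \o aligned j)
     (p \o aligned j) _ _ _ ab PS) => x y ax xy yb /=.
    by rewrite !E ?(le_trans ax)// ?(le_trans xy)//; exact: pm.
  by rewrite !E ?(le_trans ax)// ?(le_trans xy)//; exact: fp.
have down a b : a <= b -> (forall x, a <= x -> x <= b -> aligned j x = - x) ->
    `|f (aligned j b) - f (aligned j a)| <=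
    primitive (p \o aligned j) b - primitive (p \o aligned j) a.
  move=> ab E; apply: (@nonincreasing_slope_dominates _ (f \o aligned j)
     (p \o aligned j) _ _ _ ab PS) => x y ax xy yb /=.
    by rewrite !E ?(le_trans ax)// ?(le_trans xy)//; apply: pm; rewrite lerN2.
  rewrite !E ?(le_trans ax)// ?(le_trans xy)// distrC.
  have -> : y - x = - x - - y by rewrite opprK addrC.
  by apply: fp; rewrite lerN2.
move=> x y xy; case: (boolP (j \in T)) => jT.
  case: (e1 j) => ej.
    by apply: up => // z _ _; rewrite /aligned jT ej mul1r.
  by apply: down => // z _ _; rewrite /aligned jT ej mulN1r.
have Ep z : 0 <= z -> aligned j z = z by move=> z0; rewrite /aligned (negPf jT) ger0_norm.
have En z : z <= 0 -> aligned j z = - z by move=> z0; rewrite /aligned (negPf jT) ler0_norm.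
have [x0|x0] := leP 0 x.
  by apply: up => // z xz _; apply: Ep; exact: le_trans xz.
have [y0|y0] := leP y 0.
  by apply: down => // z _ zy; apply: En; exact: le_trans y0.
have h1 := down x 0 (ltW x0) (fun z _ z0 => En z z0).
have h2 := up 0 y (ltW y0) (fun z z0 _ => Ep z z0).
apply: (le_trans (ler_distD (f (aligned j 0)) _ _)).
by apply: le_trans (lerD h2 h1) _; rewrite addrA subrK.
Qed.

Lemma root_resample_le_primitive j t x y : x <= y ->
  `|root (resample t j y) - root (resample t j x)| <=
  primitive (fun z => sensitivity T w j (profile (resample t j z))) y -
  primitive (fun z => sensitivity T w j (profile (resample t j z))) x.
Proof.
move=> xy; rewrite !profile_resample.
have -> : (fun z => sensitivity T w j (profile (resample t j z))) =
    (fun s => sensitivity T w j (set_coord (profile t) j s)) \o aligned j.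
  by apply/funext => z; rewrite profile_resample.
apply: (@aligned_slope_dominates (fun s => root_slope T w (set_coord (profile t) j s))
  (fun s => sensitivity T w j (set_coord (profile t) j s)) j (w j / support_curvature T w)) => //.
- have := measurableT_comp (measurable_sensitivity j) (measurable_resample_at j t).
  by congr measurable_fun; apply/funext => z; rewrite /= profile_resample.
- by move=> z; exact: sensitivity_ge0.
- by move=> z; exact: sensitivity_le.
- by move=> a b ab; exact: sensitivity_homo.
- move=> a b ab; rewrite ger0_norm ?subr_ge0; last exact: root_slope_homo.
  exact: root_slope_increment.
Qed.

Lemma root_sub_sqr_growth c : sqr_growth (fun t => root t - c) /\
  exists C, forall t, (root t - c) ^+ 2 <= C * (1 + \sum_(i < d) (tnth t i : R) ^+ 2).
Proof.
have [C hC] := sqr_root_le.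
have S0 t : 0 <= \sum_(i < d) (tnth t i : R) ^+ 2.
  by apply: sumr_ge0 => i _; exact: sqr_ge0.
have h t : (root t - c) ^+ 2 <= (2 * C + 2 * c ^+ 2) * (1 + \sum_(i < d) (tnth t i : R) ^+ 2).
  have := hC t; have := S0 t; have := sqr_ge0 (root t + c); have := sqr_ge0 c.
  by set S := \sum_(i < d) _; nra.
split; last by eexists; exact: h.
split; first by apply: measurable_funB => //; exact: measurable_root.
exists (1 + (2 * C + 2 * c ^+ 2)) => t.
have := h t; have := normr_le_1Dsqr (root t - c); have := S0 t.
set S := \sum_(i < d) _; set K := _ + _ * c ^+ 2; nra.
Qed.

(** The minimum is bounded by the value at [0]. *)
Lemma residual_dist_root_growth : sqr_growth (fun t => residual_dist T w (profile t) (root t)).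
Proof.
split; first exact: measurable_residual_dist measurable_root.
have [_ [C hC]] := residual_dist_growth 0; exists C => t.
apply: le_trans (hC t).
rewrite !ger0_norm; try by apply: sumr_ge0 => i _; exact: sqr_ge0.
have := residual_dist_tangent T w (profile t) (root t) 0.
by rewrite root_slopeP// mulr0 subr_le0.
Qed.

Let tau : R := \int[gauss]_t root t.

(** The key estimate.  By the tangent inequality at [tau], the gap between the two
    sides is at most twice the expectation of [(root - tau) * residual_slope].
    As [tau] is the mean of the root, this is a sum over the coordinates of
    covariances between the root and functions of one coordinate that are
    [w j]-Lipschitz.  Each covariance is at most [w j] times the expected
    sensitivity, and the weighted sensitivities add up to one. *)
Lemma expected_dist_at_mean_root :
  \int[gauss]_t residual_dist T w (profile t) tau <=
  \int[gauss]_t residual_dist T w (profile t) (root t) + 2.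
Proof.
have [gr [C hC]] := root_sub_sqr_growth tau.
have ir := sqr_growth_integrable gr.
have ir0 : gauss.-integrable setT (EFin \o (fun t => root t)).
  have [g0 _] := root_sub_sqr_growth 0; have := sqr_growth_integrable g0.
  by apply: eq_integrable => // t _; rewrite /= subr0.
have r0 : \int[gauss]_t (root t - tau) = 0.
  rewrite RintegralB//; last exact: finite_measure_integrable_cst.
  by rewrite Rintegral_cst//= probability_setT/= mulr1 subrr.
pose H j (x : R) := w j * residual T w j (aligned j x) tau.
have HL j x x' : `|H j x - H j x'| <= w j * `|x - x'|.
  rewrite /H -mulrBr normrM ger0_norm// ler_wpM2l//.
  apply: le_trans (aligned_lipschitz j x x').
  have [h|/ltW h] := leP (aligned j x) (aligned j x').
    have /andP[h1 h2] := residual_homo T w j tau h.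
    rewrite distrC ger0_norm// (le_trans h2)//.
    by rewrite distrC ler_norm.
  have /andP[h1 h2] := residual_homo T w j tau h.
  by rewrite ger0_norm// (le_trans h2)// ler_norm.
have mH j : measurable_fun [set: RR] (H j).
  apply: measurable_funM => //; apply: measurable_residual => //; exact: measurable_aligned.
have gS j : sqr_growth (fun t => sensitivity T w j (profile t)).
  split; first exact: measurable_sensitivity.
  exists (w j / support_curvature T w) => t.
  rewrite ger0_norm; last exact: sensitivity_ge0.
  apply: (le_trans (sensitivity_le w0 WT0 j _)).
  rewrite ler_peMr ?divr_ge0// ?(ltW WT0)//.
  by rewrite lerDl sumr_ge0// => i _; exact: sqr_ge0.
have cov j : \int[gauss]_t (H j (tnth t j) * (root t - tau)) <=
    w j * \int[gauss]_t sensitivity T w j (profile t).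
  have := @std_gaussian_covariance_le R d j (H j) (fun t => root t - tau)
    (fun t => sensitivity T w j (profile t)) (w j) (w j / support_curvature T w) C
    (HL j) (mH j) (proj1 gr) (proj1 (gS j)) hC.
  rewrite r0 mulr0 add0r; apply.
  - by move=> t; exact: sensitivity_ge0.
  - by move=> t; exact: sensitivity_le.
  - move=> t x y xy; rewrite opprB addrA subrK; exact: root_resample_le_primitive.
have iH j : gauss.-integrable setT (EFin \o (fun t => H j (tnth t j) * (root t - tau))).
  apply: sqr_growth_integrable; exact: lipschitz_mul_sqr_growth (HL j) (mH j) (proj1 gr) hC.
have iS : gauss.-integrable setT
    (EFin \o (fun t => \sum_j (H j (tnth t j) * (root t - tau)))).
  have := @integrable_sum _ _ _ gauss setT measurableT _ (index_enum 'I_d) xpredT _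
    (fun j _ => iH j).
  by apply: eq_integrable => // t _; rewrite /= -sumEFin.
have i2S : gauss.-integrable setT
    (EFin \o (fun t => 2 * \sum_j (H j (tnth t j) * (root t - tau)))).
  have := integrableZl measurableT 2 iS.
  by apply: eq_integrable => // t _; rewrite /= -EFinM.
have iR := sqr_growth_integrable residual_dist_root_growth.
apply: (@le_trans _ _ (\int[gauss]_t (residual_dist T w (profile t) (root t) +
    2 * \sum_j (H j (tnth t j) * (root t - tau))))).
  apply: le_Rintegral => //.
  - exact: sqr_growth_integrable (residual_dist_growth tau).
  - have := integrableD measurableT iR i2S.
    by apply: eq_integrable => // t _; rewrite /= -EFinD.
  - move=> t _; rewrite -lerBlDl -mulr_suml.
    have := residual_dist_tangent T w (profile t) tau (root t).
    by move=> /le_trans; apply; rewrite -mulrA [X in 2 * X]mulrC.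
rewrite RintegralD// lerD2l RintegralZl// Rintegral_sum//.
apply: (@le_trans _ _ (2 * \sum_j w j * \int[gauss]_t sensitivity T w j (profile t))).
  by rewrite ler_wpM2l//; apply: ler_sum => j _; exact: cov.
have iw j : gauss.-integrable setT (EFin \o (fun t => w j * sensitivity T w j (profile t))).
  have := integrableZl measurableT (w j) (sqr_growth_integrable (gS j)).
  by apply: eq_integrable => // t _; rewrite /= -EFinM.
have -> : \sum_j w j * \int[gauss]_t sensitivity T w j (profile t) =
    \int[gauss]_t \sum_j w j * sensitivity T w j (profile t).
  rewrite Rintegral_sum//; apply: eq_bigr => j _.
  by rewrite RintegralZl//; exact: sqr_growth_integrable.
under eq_Rintegral do rewrite (sum_sensitivity WT0).
by rewrite Rintegral_cst//= probability_setT/= !mulr1.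
Qed.

End Gaussian.

(** * The expected squared distance *)

Section Expect.
Context {R : realType}.
Local Notation RR := (measurableTypeR R).
Local Notation mu := (@lebesgue_measure R).
Local Notation gpdf := (normal_pdf (0 : R) 1).
Local Notation gam := (normal_prob (0 : R) 1).

(** Reconciles the normalization of the density with the constant in [phi], which
    counts the two tails of the Gaussian. *)
Lemma normal_peak1_double : normal_peak 1 + normal_peak 1 = Num.sqrt (2 / pi) :> R.
Proof.
rewrite /normal_peak; move: (pi : R) (pi_gt0 R) => q q0.
have q2 : 0 <= 1 ^+ 2 * q *+ 2 by rewrite expr1n mul1r mulrn_wge0// ltW.
rewrite -mulr2n -[LHS]ger0_norm; last by rewrite mulrn_wge0// invr_ge0.
rewrite -sqrtr_sqr; congr Num.sqrt.
rewrite -[X in X ^+ 2]mulr_natr exprMn exprVn sqr_sqrtr//.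
rewrite expr1n mul1r -[q *+ 2]mulr_natr; field.
by rewrite gt_eqF.
Qed.

Lemma Rintegral_soft_threshold t : 0 <= t ->
  \int[gam]_x (Num.max (`|x| - t) 0) ^+ 2 = phi t.
Proof.
move=> t0; rewrite /phi /Rintegral.
pose f (x : RR) : R := Num.max (`|x| - t) 0 ^+ 2.
have mf : measurable_fun [set: RR] f.
  apply: measurable_funX; apply: measurable_maxr => //.
  by apply: measurable_funB => //; exact: normr_measurable.
have mg : measurable_fun [set: RR] gpdf by exact: measurable_normal_pdf.
have f0 x : 0 <= f x by exact: sqr_ge0.
have p0 : 0 < normal_peak (1 : R) by rewrite normal_peak_gt0// oner_eq0.
set I := (\int[mu]_(x in _) _)%E.
have half : (\int[mu]_(x in `[0%R, +oo[) ((f x)%:E * (gpdf x)%:E) = (normal_peak (1:R))%:E * I)%E.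
  rewrite -ge0_integralZl//=; last 3 first.
  - apply/measurable_EFinP/measurable_funTS; apply: measurable_funM.
      by apply: measurable_funX; apply: measurable_funB.
    apply: measurableT_comp => //; apply: measurable_funM => //.
    by apply: measurableT_comp => //; exact: measurable_funX.
  - by move=> x _; rewrite lee_fin mulr_ge0 ?sqr_ge0 ?expR_ge0.
  - by rewrite lee_fin ltW.
  rewrite [LHS]integral_mkcond [RHS]integral_mkcond; apply: eq_integral => x _.
  rewrite !patchE !mem_setE !in_itv/= !andbT /f.
  have [tx|xt] := leP t x.
    rewrite (le_trans t0 tx) ger0_norm ?(le_trans t0 tx)//.
    rewrite (max_idPl _) ?subr_ge0// std_normal_pdfE -!EFinM; congr EFin; ring.
  case: ifP => // x0; rewrite ger0_norm// (max_idPr _) ?subr_le0 ?(ltW xt)//.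
  by rewrite expr0n/= mul0e.
transitivity (fine ((normal_peak (1:R))%:E * I + (normal_peak (1:R))%:E * I)%E).
  congr fine.
  have f0E x : (0 <= (f x)%:E)%E by rewrite lee_fin.
  have mfE : measurable_fun [set: RR] (EFin \o f) by exact/measurable_EFinP.
  rewrite (ge0_integral_normal_prob 0 1 mfE f0E).
  rewrite ge0_integral_fold; first last.
  - by move=> x; apply: mule_ge0; rewrite lee_fin// normal_pdf_ge0.
  - by apply: emeasurable_funM; exact/measurable_EFinP.
  apply: f_equal2; apply: etrans half; first by [].
  by apply: eq_integral => x _; rewrite /= /f normrN std_normal_pdfN.
rewrite -normal_peak1_double.
case: I {half} => [r| |] /=.
- by rewrite mulrDl.
- by rewrite mulry gtr0_sg// mul1e/= mulr0.
- by rewrite mulrNy gtr0_sg// mul1e/= mulr0.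
Qed.

Lemma Rintegral_shift_sqr (a c : R) : a ^+ 2 = 1 ->
  \int[gam]_x (a * x - c) ^+ 2 = 1 + c ^+ 2.
Proof.
move=> a1.
have mid := @measurable_id _ RR setT.
have i1 : gam.-integrable setT (EFin \o (fun x : RR => x : R)).
  by apply: (@std_normal_integrable _ _ 1) => // x; rewrite mul1r normr_le_1Dsqr.
have i2 : gam.-integrable setT (EFin \o (fun x : RR => (x : R) ^+ 2)).
  apply: (@std_normal_integrable _ _ 1); first exact: measurable_funX.
  by move=> x; rewrite mul1r ger0_norm ?sqr_ge0// lerDr.
transitivity (\int[gam]_x (x ^+ 2 + (- 2 * a * c) * x + 0 * x + c ^+ 2)).
  apply: eq_Rintegral => x _.
  have -> : (a * x - c) ^+ 2 = a ^+ 2 * x ^+ 2 + (- 2 * a * c) * x + 0 * x + c ^+ 2 by ring.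
  by rewrite a1 mul1r.
rewrite Rintegral_affine3// Rintegral_sqr_std_normal Rintegral_id_std_normal.
by rewrite !mulr0 !addr0.
Qed.

Section J.
Context {d : nat}.
Local Notation gauss := (@std_gaussian R d).
Variables (T : {set 'I_d}) (w : 'I_d -> R) (e : 'I_d -> R).
Hypothesis w0 : forall j, 0 <= w j.
Hypothesis e1 : forall j, e j = 1 \/ e j = -1.

(** The expected squared distance from a Gaussian vector to [t] times the
    subdifferential; dividing by the dimension gives the function that is
    minimized in [m_tilde]. *)
Definition expected_dist (t : R) : R :=
  \sum_(j in T) (1 + (t * w j) ^+ 2) + \sum_(j in ~: T) phi (t * w j).

Let h j c (x : R) : R := residual T w j (aligned T e j x) c ^+ 2.

Let mh j c : measurable_fun [set: RR] (h j c).
Proof.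
apply: measurable_funX; apply: measurable_residual => //; exact: measurable_aligned.
Qed.

Let h_integrable j c : gam.-integrable setT (EFin \o h j c).
Proof.
apply: (@std_normal_integrable _ _ (2 * (1 + (`|c| * w j) ^+ 2))) => // x.
rewrite /h ger0_norm ?sqr_ge0//.
have := ler_sqr_normD (residual_growth T w0 e1 j x c).
by have := sqr_ge0 (`|c| * w j); have := sqr_ge0 x; nra.
Qed.

Lemma Rintegral_residual_dist c :
  \int[gauss]_t residual_dist T w (profile T e t) c = \sum_j \int[gam]_x h j c x.
Proof.
have E j : \int[gauss]_t h j c (tnth t j) = \int[gam]_x h j c x.
  by rewrite /Rintegral (integral_std_gaussian_coord j (mh j c))// => x; exact: sqr_ge0.
rewrite /residual_dist Rintegral_sum; last first.
  move=> j; apply/integrableP; split.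
    by apply/measurable_EFinP; apply: (measurableT_comp (mh j c)); exact: measurable_tnth.
  under eq_integral do rewrite /= ger0_norm ?sqr_ge0//.
  rewrite (integral_std_gaussian_coord j (mh j c)); last by move=> x; exact: sqr_ge0.
  have /integrableP[_] := h_integrable j c.
  by under eq_integral do rewrite /= ger0_norm ?sqr_ge0//.
by apply: eq_bigr => j _; exact: E.
Qed.

Let hT j c : j \in T -> \int[gam]_x h j c x = 1 + (c * w j) ^+ 2.
Proof.
move=> jT; rewrite -(@Rintegral_shift_sqr (e j)); last first.
  by case: (e1 j) => ->; rewrite ?sqrrN expr1n.
by apply: eq_Rintegral => x _; rewrite /h /residual /aligned jT.
Qed.

Let hN j c : j \notin T -> 0 <= c -> \int[gam]_x h j c x = phi (c * w j).
Proof.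
move=> /negPf jT c0; rewrite -Rintegral_soft_threshold ?mulr_ge0//.
by apply: eq_Rintegral => x _; rewrite /h /residual /aligned jT.
Qed.

Lemma expected_distE c : 0 <= c ->
  \int[gauss]_t residual_dist T w (profile T e t) c = expected_dist c.
Proof.
move=> c0; rewrite Rintegral_residual_dist (bigID (mem T))/=; congr (_ + _).
  by apply: eq_bigr => j jT; exact: hT.
by apply: eq_big => [j|j jT]; [rewrite inE|exact: hN].
Qed.

Lemma expected_dist0_le c : c <= 0 ->
  expected_dist 0 <= \int[gauss]_t residual_dist T w (profile T e t) c.
Proof.
move=> c0; rewrite -expected_distE// !Rintegral_residual_dist.
apply: ler_sum => j _; have [jT|jT] := boolP (j \in T).
  by rewrite !hT// mul0r expr0n/= addr0 lerDl sqr_ge0.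
apply: le_Rintegral => // x _.
rewrite /h /residual (negPf jT) mul0r subr0.
set a := aligned _ _ _ _.
have cw : 0 <= - (c * w j) by rewrite -mulNr mulr_ge0// oppr_ge0.
have m0 z : 0 <= Num.max z 0 :> R by rewrite le_max lexx orbT.
rewrite ler_sqr ?nnegrE ?m0// ge_max m0 andbT le_max; apply/orP; left.
by move: cw; lra.
Qed.

Lemma expected_dist_le_quadratic c : 0 <= c ->
  expected_dist c <= expected_dist 0 + c ^+ 2 * support_curvature T w.
Proof.
move=> c0; rewrite -!expected_distE// !Rintegral_residual_dist.
rewrite /support_curvature [X in _ * X]big_mkcond/= mulr_sumr -big_split/=.
apply: ler_sum => j _; have [jT|jT] := boolP (j \in T).
  by rewrite !hT// mul0r expr0n/= addr0 exprMn.
rewrite mulr0 addr0; apply: le_Rintegral => // x _.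
rewrite /h /residual (negPf jT) mul0r subr0.
have cw : 0 <= c * w j by rewrite mulr_ge0.
have m0 z : 0 <= Num.max z 0 :> R by rewrite le_max lexx orbT.
rewrite ler_sqr ?nnegrE ?m0// ge_max m0 andbT le_max; apply/orP; left.
by move: cw; lra.
Qed.

(** The mean of the root may have any sign, whereas the infimum ranges over
    positive parameters: negative parameters are no better than [0], and [0] is
    a limit of positive ones by the quadratic estimate. *)
Lemma inf_expected_dist_le (m c : R) : (forall t, 0 < t -> m <= expected_dist t) ->
  m <= \int[gauss]_t residual_dist T w (profile T e t) c.
Proof.
move=> hm; have [c0|c0] := ltP 0 c; first by rewrite (expected_distE (ltW c0)); exact: hm.
apply: le_trans (expected_dist0_le c0).
apply/ler_addgt0Pr => eps eps0.
have W0 : 0 <= support_curvature T w by apply: sumr_ge0 => j _; exact: sqr_ge0.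
set W := support_curvature T w in W0.
(* chosen so that [x ^+ 2 * W <= eps]; the summand 1 covers [W = 0] *)
pose x := Num.sqrt (eps / (1 + W)).
have W1 : 0 < 1 + W by rewrite ltr_pwDl.
have x0 : 0 < x by rewrite sqrtr_gt0 divr_gt0.
apply: (le_trans (hm x x0)); apply: (le_trans (expected_dist_le_quadratic (ltW x0))).
have q0 : 0 <= eps / (1 + W) by rewrite divr_ge0// ltW.
rewrite lerD2l sqr_sqrtr// mulrAC ler_pdivrMr//; apply: ler_wpM2l; first exact: ltW.
by rewrite lerDr.
Qed.
End J.
End Expect.

(** * Projection onto the descent cone *)

Section Cone.
Context {R : realType} {d : nat}.
Variables (x0 w : 'rV[R]_d).
Hypothesis w0 : forall j, 0 <= w 0 j.
Implicit Types (u v p q : 'rV[R]_d) (j : 'I_d).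

Local Notation T := (supp x0).

(** The value [1] at a zero entry is arbitrary; it keeps [sign_of] unimodular
    everywhere. *)
Definition sign_of j : R := if 0 <= x0 0 j then 1 else -1.

Lemma sign_of1 j : sign_of j = 1 \/ sign_of j = -1.
Proof. by rewrite /sign_of; case: ifP; [left|right]. Qed.

Local Notation align j x := (aligned T sign_of j x).
Local Notation res := (residual T (fun j => w 0 j)).

(** The directional derivative of the weighted norm at [x0]. *)
Definition directional_l1 v : R := \sum_j w 0 j * align j (v 0 j).

Lemma sign_of_sqr j : sign_of j * sign_of j = 1.
Proof. by case: (sign_of1 j) => ->; rewrite ?mulrNN mulr1. Qed.

Lemma sign_of_abs j : sign_of j * x0 0 j = `|x0 0 j|.
Proof.
rewrite /sign_of; case: ifPn => [h|]; first by rewrite mul1r ger0_norm.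
by rewrite -ltNge => h; rewrite mulN1r ltr0_norm.
Qed.

Lemma align_norm_le v j t : 0 <= t ->
  `|x0 0 j| + t * align j (v 0 j) <= `|x0 0 j + t * v 0 j|.
Proof.
move=> t0; rewrite /aligned inE; case: eqVneq => [->|x0j] /=.
  by rewrite normr0 !add0r normrM ger0_norm.
rewrite -sign_of_abs.
have -> : sign_of j * x0 0 j + t * (sign_of j * v 0 j) = sign_of j * (x0 0 j + t * v 0 j) by ring.
apply: le_trans (ler_norm _) _; rewrite normrM.
by case: (sign_of1 j) => ->; rewrite ?normrN normr1 mul1r.
Qed.

Lemma align_norm_eq v j t : 0 <= t -> (j \in T -> t * `|v 0 j| <= `|x0 0 j|) ->
  `|x0 0 j + t * v 0 j| = `|x0 0 j| + t * align j (v 0 j).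
Proof.
move=> t0; rewrite /aligned inE; case: eqVneq => [->|x0j] /= h.
  by rewrite normr0 !add0r normrM ger0_norm.
have {}h := h isT.
have h2 : - (t * `|v 0 j|) <= t * (sign_of j * v 0 j).
  rewrite -mulrN ler_wpM2l//; case: (sign_of1 j) => ->; rewrite ?mul1r ?mulN1r.
    by rewrite lerNl -normrN ler_norm.
  by rewrite lerN2 ler_norm.
have h3 : 0 <= `|x0 0 j| + t * (sign_of j * v 0 j) by lra.
rewrite -[RHS]ger0_norm// -sign_of_abs.
have -> : sign_of j * x0 0 j + t * (sign_of j * v 0 j) = sign_of j * (x0 0 j + t * v 0 j) by ring.
by rewrite normrM; case: (sign_of1 j) => ->; rewrite ?normrN normr1 mul1r.
Qed.

(** The norm lies above its directional linearization, and agrees with it for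
    steps so short that no entry on the support changes sign.  Hence the descent
    cone is the closed set where the directional derivative is nonpositive. *)
Lemma descent_cone_l1E :
  descent_cone (weighted_l1 w) x0 = [set v | directional_l1 v <= 0].
Proof.
apply/seteqP; split => v /=.
  move=> [t t0]; rewrite /weighted_l1 -subr_le0 -sumrB => h.
  rewrite -(pmulr_rle0 _ t0) /directional_l1 mulr_sumr (le_trans _ h)//.
  apply: ler_sum => j _; rewrite !mxE -mulrBr mulrCA ler_wpM2l//.
  by rewrite lerBrDl; apply: align_norm_le; exact: ltW.
(* the step 1/S keeps the sign of every entry on the support *)
move=> h; pose S := 1 + \sum_(j in T) `|v 0 j| / `|x0 0 j|.
have S0 : 0 < S by rewrite ltr_pwDl// sumr_ge0.
exists S^-1; first by rewrite invr_gt0.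
rewrite /weighted_l1 -subr_le0 -sumrB.
rewrite (_ : \sum_j _ = S^-1 * directional_l1 v).
  by rewrite pmulr_rle0 ?invr_gt0.
rewrite /directional_l1 mulr_sumr; apply: eq_bigr => j _.
rewrite !mxE -mulrBr mulrCA; congr (_ * _).
rewrite align_norm_eq ?invr_ge0 ?(ltW S0)//; first by rewrite addrAC subrr add0r.
move=> jT; have xj : 0 < `|x0 0 j| by rewrite normr_gt0; move: jT; rewrite inE.
rewrite mulrC ler_pdivrMr// mulrC -ler_pdivrMr//.
rewrite /S (bigD1 j)//= ler_wpDl// lerDl sumr_ge0//.
Qed.

Lemma descent_cone_l1_closed : closed (descent_cone (weighted_l1 w) x0).
Proof.
rewrite descent_cone_l1E.
have c : continuous directional_l1.
  move=> v.
  have cj j : (fun u : 'rV[R]_d => w 0 j * align j (u 0 j)) u @[u --> v] -->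
      w 0 j * align j (v 0 j).
    apply: (@continuous_comp _ _ _ (fun u : 'rV[R]_d => u 0 j) (fun x => w 0 j * align j x)).
      exact: coord_continuous.
    apply: cvgM; first exact: cvg_cst.
    rewrite /aligned; case: (j \in T); last exact: norm_continuous.
    by apply: cvgM; [exact: cvg_cst|exact: cvg_id].
  rewrite /directional_l1; apply: cvg_big => [||j _].
  - exact: add_continuous.
  - exact: (nbhs_filter v).
  - exact: cj.
have := @closed_comp _ _ directional_l1 [set r : R | r <= 0] (fun v _ => c v) (@closed_le R 0).
by [].
Qed.

Lemma norm2_sqr v : norm2 v ^+ 2 = \sum_j v 0 j ^+ 2.
Proof. by rewrite /norm2 sqr_sqrtr// sumr_ge0// => j _; exact: sqr_ge0. Qed.

Lemma norm2_le u v : (norm2 u <= norm2 v) = (\sum_j u 0 j ^+ 2 <= \sum_j v 0 j ^+ 2).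
Proof.
by rewrite -!norm2_sqr ler_sqr// nnegrE sqrtr_ge0.
Qed.

(** Moreau's characterization of the projection onto a cone: the error is
    orthogonal to [p] and makes an obtuse angle with the cone, so by Pythagoras
    [p] is the only nearest point. *)
Lemma metric_projE (C : set 'rV[R]_d) u p : C p ->
  \sum_j (u 0 j - p 0 j) * p 0 j = 0 ->
  (forall q, C q -> \sum_j (u 0 j - p 0 j) * q 0 j <= 0) ->
  metric_proj C u = p.
Proof.
move=> Cp pp pq.
have key q : C q -> \sum_j (u - p) 0 j ^+ 2 + \sum_j (p 0 j - q 0 j) ^+ 2 <=
    \sum_j (u - q) 0 j ^+ 2.
  move=> Cq; have := pq q Cq.
  suff -> : \sum_j (u - q) 0 j ^+ 2 = \sum_j (u - p) 0 j ^+ 2 + \sum_j (p 0 j - q 0 j) ^+ 2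
      + (2 * \sum_j (u 0 j - p 0 j) * p 0 j - 2 * \sum_j (u 0 j - p 0 j) * q 0 j).
    by rewrite pp; lra.
  rewrite !mulr_sumr -sumrB -!big_split/=; apply: eq_bigr => j _; rewrite !mxE; ring.
rewrite /metric_proj; case: xgetP => [p' _ [Cp' np']|no]; last first.
  exfalso; apply: (no p); split => // q Cq; rewrite norm2_le.
  apply: le_trans (key q Cq); rewrite lerDl sumr_ge0// => j _; exact: sqr_ge0.
have := np' p Cp; rewrite norm2_le => h.
have := key p' Cp' => h2.
have : \sum_j (p 0 j - p' 0 j) ^+ 2 <= 0 by lra.
rewrite le_eqVlt ltNge sumr_ge0 ?orbF; last by move=> j _; exact: sqr_ge0.
rewrite psumr_eq0; last by move=> j _; exact: sqr_ge0.
move=> /allP hall; apply/rowP => j.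
have := hall j (mem_index_enum j); rewrite sqrf_eq0 subr_eq0 => /eqP ->//.
Qed.

Lemma residual_off_support (u : R) j t : 0 <= t -> j \notin T ->
  [/\ 0 <= res j `|u| t, res j `|u| t <= `|u|,
    `|u| - res j `|u| t <= t * w 0 j &
    (`|u| - res j `|u| t) * res j `|u| t = t * w 0 j * res j `|u| t].
Proof.
move=> t0 /negPf jT; rewrite /residual jT.
have tw : 0 <= t * w 0 j by rewrite mulr_ge0.
have u0 := normr_ge0 u.
have [h|h] := leP (`|u| - t * w 0 j) 0; split; lra.
Qed.

(** The squared norm of the projection onto the descent cone is the squared
    distance to the polar cone, which is generated by the subdifferential.  The
    two hypotheses on [t] are the optimality conditions of the distance over
    [t >= 0]; the projection is then obtained from [u] by shrinking every entry
    to its residual. *)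
Lemma norm2_proj_descent_cone u t :
  let y := fun j => align j (u 0 j) in
  0 <= t -> residual_slope T (fun j => w 0 j) y t <= 0 ->
  t * residual_slope T (fun j => w 0 j) y t = 0 ->
  norm2 (metric_proj (closure (descent_cone (weighted_l1 w) x0)) u) ^+ 2 =
  residual_dist T (fun j => w 0 j) y t.
Proof.
move=> y t0 G0 tG.
rewrite -(proj1 (closure_id _) descent_cone_l1_closed).
(* the entry of [u] is its sign [s] times [y]; the projection keeps the sign *)
pose s j : R := if j \in T then sign_of j else Num.sg (u 0 j).
pose a j := res j (y j) t.
pose p := \row_j (s j * a j).
have uE j : u 0 j = s j * y j.
  rewrite /s /y /aligned; case: ifP => _; last exact: numEsg.
  by rewrite mulrA sign_of_sqr mul1r.
have offT j : j \notin T -> y j = `|u 0 j| by move=> /negPf jT; rewrite /y /aligned jT.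
have s0 j : s j = 0 -> a j = 0.
  rewrite /s; case: ifPn => [_|jT].
    by case: (sign_of1 j) => -> /eqP; rewrite ?oppr_eq0 oner_eq0.
  move=> /eqP; rewrite sgr_eq0 => /eqP u0.
  have [h1 h2 _ _] := residual_off_support (u 0 j) t0 jT.
  rewrite /a offT//; apply/eqP; rewrite eq_le h1 andbT (le_trans h2)//.
  by rewrite u0 normr0.
have ss j : s j != 0 -> s j * s j = 1.
  rewrite /s; case: ifPn => [_ _|jT]; first exact: sign_of_sqr.
  by rewrite sgr_eq0 -expr2 sqr_sg => ->.
have ssa j : s j * s j * a j = a j.
  by have [/s0 ->|/ss ->] := eqVneq (s j) 0; rewrite ?mulr0 ?mul1r.
have alp j : align j (p 0 j) = a j.
  rewrite mxE /aligned; case: ifPn => jT.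
    by rewrite /s jT mulrA sign_of_sqr mul1r.
  have [h1 _ _ _] := residual_off_support (u 0 j) t0 jT.
  rewrite normrM [`|a j|]ger0_norm; last by rewrite /a offT.
  have [s00|sn0] := eqVneq (s j) 0; first by rewrite s0// mulr0.
  have : `|s j| = 1 by move: sn0; rewrite /s (negPf jT) sgr_eq0 normr_sg => ->.
  by move=> ->; rewrite mul1r.
have lp : directional_l1 p = residual_slope T (fun j => w 0 j) y t.
  by apply: eq_bigr => j _; rewrite alp.
have upp j : (u 0 j - p 0 j) * p 0 j = t * (w 0 j * a j).
  rewrite mxE uE.
  have -> : (s j * y j - s j * a j) * (s j * a j) = (y j - a j) * (s j * s j * a j) by ring.
  rewrite ssa; have [jT|jT] := boolP (j \in T).
    by rewrite /a /residual jT; ring.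
  have [_ _ _ h] := residual_off_support (u 0 j) t0 jT.
  by rewrite /a offT// h mulrA.
have upq q j : (u 0 j - p 0 j) * q 0 j <= t * (w 0 j * align j (q 0 j)).
  rewrite mxE uE -mulrBr; have [jT|jT] := boolP (j \in T).
    by rewrite /a /residual /s /aligned jT le_eqVlt; apply/orP; left; apply/eqP; ring.
  have [_ h1 h2 _] := residual_off_support (u 0 j) t0 jT.
  rewrite /aligned (negPf jT) (le_trans (ler_norm _))// normrM mulrA ler_wpM2r//.
  have hya : `|y j - a j| <= t * w 0 j.
    by rewrite /a offT// ger0_norm ?subr_ge0.
  rewrite normrM -[leRHS]mul1r ler_pM//.
  by rewrite /s (negPf jT) normr_sg; case: (_ != 0).
have -> : metric_proj (descent_cone (weighted_l1 w) x0) u = p.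
  apply: metric_projE.
  - by rewrite descent_cone_l1E /= lp.
  - under eq_bigr do rewrite upp; by rewrite -mulr_sumr.
  - rewrite descent_cone_l1E /= => q hq.
    apply: (@le_trans _ _ (t * directional_l1 q)); last by rewrite mulr_ge0_le0.
    by rewrite mulr_sumr; apply: ler_sum => j _; exact: upq.
rewrite norm2_sqr; apply: eq_bigr => j _.
rewrite mxE -/(a j).
have -> : (s j * a j) ^+ 2 = (s j * s j * a j) * a j by ring.
by rewrite ssa expr2.
Qed.

End Cone.

(** * Statistical dimension of the descent cone *)

Section StatDim.
Context {R : realType} {d : nat}.
Variables (x0 w : 'rV[R]_d).
Hypothesis w0 : forall j, 0 <= w 0 j.
Local Notation T := (supp x0).
Local Notation ws := (fun j => w 0 j).
Local Notation gauss := (@std_gaussian R d).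
Local Notation prof := (profile T (sign_of x0)).
Local Notation cone := (descent_cone (weighted_l1 w) x0).

Lemma stat_dim_Rintegral (f : d.-tuple (measurableTypeR R) -> R) : sqr_growth f ->
  (forall t, norm2 (metric_proj (closure cone) (gaussian_vec t)) ^+ 2 = f t) ->
  stat_dim cone = (\int[gauss]_t f t)%:E.
Proof.
move=> gf fE; rewrite /stat_dim unlock /Rintegral fineK.
  by apply: eq_integral => t _; rewrite fE.
by apply: integrable_fin_num => //; exact: sqr_growth_integrable.
Qed.

Lemma profile_gaussian_vec (t : d.-tuple (measurableTypeR R)) :
  (fun j => aligned T (sign_of x0) j ((gaussian_vec t) 0 j)) = prof t.
Proof. by apply/funext => j; rewrite /gaussian_vec mxE. Qed.

(** In the first case the optimal multiple is the positive part of the root; in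
    the second one the weighted norm vanishes and the distance does not depend
    on the multiple. *)
Lemma stat_dim_bounds : 0 < support_curvature T ws \/ (forall j, w 0 j = 0) ->
  exists r : R, [/\ stat_dim cone = r%:E,
    forall t, 0 < t -> r <= expected_dist T ws t &
    forall m, (forall t, 0 < t -> m <= expected_dist T ws t) -> m <= r + 2].
Proof.
have e1 := sign_of1 x0.
have proj t c := @norm2_proj_descent_cone _ _ x0 w w0 (gaussian_vec t) c.
have gdist c := @residual_dist_growth _ _ T ws _ w0 e1 c.
case=> [W0|wz].
  pose c (t : d.-tuple (measurableTypeR R)) := Num.max (root_slope T ws (prof t)) 0.
  have mroot := @measurable_root _ _ T ws _ w0 W0.
  have c0 t : 0 <= c t by rewrite /c le_max lexx orbT.
  have cG t : residual_slope T ws (prof t) (c t) <= 0.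
    by rewrite -(root_slope_le w0 W0) /c le_max lexx.
  have cGc t : c t * residual_slope T ws (prof t) (c t) = 0.
    rewrite /c; have [h|h] := leP (root_slope T ws (prof t)) 0; first by rewrite mul0r.
    by rewrite (root_slopeP w0 W0) mulr0.
  pose f t := residual_dist T ws (prof t) (c t).
  have f_le t s : 0 < s -> f t <= residual_dist T ws (prof t) s.
    move=> s0; rewrite -subr_le0 /f.
    apply: (le_trans (residual_dist_tangent T ws (prof t) (c t) s)).
    have -> : 2 * (s - c t) * residual_slope T ws (prof t) (c t) =
      2 * (s * residual_slope T ws (prof t) (c t)) -
      2 * (c t * residual_slope T ws (prof t) (c t)) by ring.
    rewrite cGc mulr0 subr0 mulr_ge0_le0// mulr_ge0_le0//; exact: ltW.
  have f_ge t : residual_dist T ws (prof t) (root_slope T ws (prof t)) <= f t.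
    rewrite -subr_le0 /f.
    apply: (le_trans (residual_dist_tangent T ws (prof t) _ _)).
    by rewrite (root_slopeP w0 W0) mulr0.
  have gf : sqr_growth f.
    split.
      apply: measurable_residual_dist; apply: measurable_maxr => //; exact: mroot.
    have [_ [C hC]] := gdist 1; exists C => t; apply: le_trans (hC t).
    rewrite !ger0_norm ?f_le//; by apply: sumr_ge0 => j _; exact: sqr_ge0.
  exists (\int[gauss]_t f t); split.
  - apply: stat_dim_Rintegral => // t; have := proj t (c t).
    by rewrite profile_gaussian_vec; apply.
  - move=> s s0; rewrite -(expected_distE T w0 e1 (ltW s0)).
    apply: le_Rintegral => //; [exact: sqr_growth_integrable|exact: sqr_growth_integrable|].
    by move=> t _; exact: f_le.
  - move=> m hm.
    apply: (le_trans (inf_expected_dist_le w0 e1 (\int[gauss]_t root_slope T ws (prof t)) hm)).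
    apply: (le_trans (expected_dist_at_mean_root w0 e1 W0)).
    rewrite lerD2r; apply: le_Rintegral => //.
    + exact: sqr_growth_integrable (residual_dist_root_growth w0 e1 W0).
    + exact: sqr_growth_integrable.
have resE t c : residual_dist T ws (prof t) c = residual_dist T ws (prof t) 0.
  by apply: eq_bigr => j _; rewrite /residual wz !mulr0.
have slopeE y c : residual_slope T ws y c = 0.
  by rewrite /residual_slope big1// => j _; rewrite wz mul0r.
have distE c : 0 <= c ->
    expected_dist T ws c = \int[gauss]_t residual_dist T ws (prof t) 0.
  move=> c0; rewrite -(expected_distE T w0 e1 c0).
  by apply: eq_Rintegral => t _; exact: resE.
exists (\int[gauss]_t residual_dist T ws (prof t) 0); split.
- apply: stat_dim_Rintegral => // t; have := proj t 0.
  rewrite profile_gaussian_vec; apply => //; first by rewrite (slopeE (prof t)).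
  by rewrite mul0r.
- by move=> s s0; rewrite distE// ltW.
- move=> m hm; have := hm 1 ltr01; rewrite distE//; lra.
Qed.
End StatDim.

(** * Weights that are constant on blocks *)

Section Blocks.
Context {R : realType} {d k : nat}.
Variables (S : 'I_k -> {set 'I_d}).
Hypothesis hS : is_partition S.

Lemma partition_block : {b : 'I_d -> 'I_k | forall i j, (j \in S i) = (b j == i)}.
Proof.
have [injS /and3P[/eqP cov triv _]] := hS.
have ex j : exists i, j \in S i.
  have : j \in finset.cover (S @: [set: 'I_k]%SET) by rewrite cov inE.
  by move=> /finset.bigcupP[_ /imsetP[i _ ->] ji]; exists i.
pose b j := xchoose (ex j).
have bP j : j \in S (b j) by exact: (xchooseP (ex j)).
exists b => i j; apply/idP/eqP => [ji|<-//].
apply: injS; apply/eqP/negPn/negP => bi.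
have /finset.trivIsetP/(_ (S (b j)) (S i)) := triv.
rewrite !imset_f ?inE//= => /(_ isT isT bi); rewrite -setI_eq0 => /eqP/setP/(_ j).
by rewrite !inE bP ji.
Qed.

Lemma sum_by_block (A : {set 'I_d}) (g : 'I_k -> R) (b : 'I_d -> 'I_k) :
  (forall i j, (j \in S i) = (b j == i)) ->
  \sum_(j in A) g (b j) = \sum_i #|A :&: S i|%:R * g i.
Proof.
move=> hb; rewrite (partition_big b xpredT)//=; apply: eq_bigr => i _.
rewrite (eq_bigr (fun=> g i)); last by move=> j /andP[_ /eqP ->].
rewrite sumr_const mulr_natl; congr (_ *+ _).
by apply: eq_card => j; rewrite !inE hb.
Qed.

Variable omega : 'I_k -> R.

Lemma block_weightsE (b : 'I_d -> 'I_k) j :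
  (forall i j, (j \in S i) = (b j == i)) ->
  block_weights S omega 0 j = omega (b j).
Proof.
move=> hb; rewrite /block_weights summxE (bigD1 (b j))//= big1 ?addr0.
  by rewrite !mxE hb eqxx mulr1.
by move=> i ib; rewrite !mxE hb eq_sym (negPf ib) mulr0.
Qed.

(** Grouping the coordinates by blocks. *)
Lemma sample_complexity_expected_dist (T : {set 'I_d}) t :
  (forall i, S i :&: T != finset.set0)%SET ->
  #|T|%:R / d%:R + \sum_(i < k) rho S i * (alpha S T i * (omega i * t) ^+ 2 +
     (1 - alpha S T i) * phi (omega i * t)) =
  expected_dist T (fun j => block_weights S omega 0 j) t / d%:R.
Proof.
move=> hST; have [b hb] := partition_block.
rewrite /expected_dist.
under [\sum_(j in T) _]eq_bigr do rewrite (block_weightsE _ hb) mulrC.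
under [\sum_(j in ~: T) _]eq_bigr do rewrite (block_weightsE _ hb) mulrC.
rewrite big_split/= sumr_const (sum_by_block T (fun i => (omega i * t) ^+ 2) hb).
rewrite (sum_by_block (~: T) (fun i => phi (omega i * t)) hb).
rewrite -addrA mulrDl -big_split/= mulr_suml; congr (_ + _).
apply: eq_bigr => i _; rewrite /rho /alpha.
have S0 : #|S i|%:R != 0 :> R.
  rewrite pnatr_eq0 cards_eq0; apply: contraNneq (hST i) => ->.
  by rewrite finset.set0I.
have -> : #|~: T :&: S i|%:R = #|S i|%:R - #|T :&: S i|%:R :> R.
  rewrite -(cardsID T (S i)) natrD finset.setIC -finset.setDE.
  by rewrite [_ :&: T]finset.setIC addrAC subrr add0r.
have [d0|d0] := eqVneq (d%:R : R) 0; last by field; rewrite S0 d0.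
by rewrite d0 invr0 !mulr0 mul0r.
Qed.

End Blocks.

Theorem proposition9 (R : realType) (d k : nat) (hd : (0 < d)%N)
    (x0 : 'rV[R]_d) (T : {set 'I_d}) (hT : T = supp x0)
    (S : 'I_k -> {set 'I_d}) (hS : is_partition S)
    (hST : forall i, (S i :&: T)%SET != finset.set0)
    (omega : 'I_k -> R) (homega : forall i, 0 <= omega i)
    (w : 'rV[R]_d) (hw : w = block_weights S omega) :
  let delta := stat_dim (descent_cone (weighted_l1 w) x0) in
  let m := m_tilde S T omega in
  let abar : R := alpha_min S T in
  ((m - 2 / d%:R * Num.sqrt (1 / abar))%:E <= delta * (d%:R^-1)%:E <= m%:E)%E
  /\
  ((m - 2 / Num.sqrt d%:R)%:E <= delta * (d%:R^-1)%:E <= m%:E)%E.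
Proof.
move=> delta m abar.
have d0 : 0 < d%:R :> R by rewrite ltr0n.
have [b hb] := partition_block hS.
have wE j : w 0 j = omega (b j) by rewrite hw (block_weightsE _ _ hb).
have w0 j : 0 <= w 0 j by rewrite wE.
(* every block meets the support, so weights that vanish there vanish everywhere *)
have hW : 0 < support_curvature (supp x0) (fun j => w 0 j) \/ (forall j, w 0 j = 0).
  have W0 : 0 <= support_curvature (supp x0) (fun j => w 0 j).
    by apply: sumr_ge0 => j _; exact: sqr_ge0.
  move: W0; rewrite le_eqVlt => /predU1P[W0|]; last by left.
  right=> j; rewrite wE.
  have /set0Pn[l] := hST (b j); rewrite inE hb => /andP[/eqP bl lT].
  rewrite -bl -wE; apply/eqP; rewrite -sqrf_eq0.
  have /eqP := esym W0; rewrite psumr_eq0; last by move=> i _; exact: sqr_ge0.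
  by move=> /allP/(_ l (mem_index_enum l)); rewrite -hT lT.
have [r [rE r_le r_ge]] := stat_dim_bounds w0 hW.
pose J t := expected_dist (supp x0) (fun j => w 0 j) t.
have elt t : #|T|%:R / d%:R + \sum_(i < k) rho S i * (alpha S T i * (omega i * t) ^+ 2 +
     (1 - alpha S T i) * phi (omega i * t)) = J t / d%:R.
  by rewrite sample_complexity_expected_dist// -hw hT.
have r_m : r / d%:R <= m.
  apply: lb_le_inf; first by eexists; exists 1; [exact: ltr01|reflexivity].
  by move=> _ /= [t t0 <-]; rewrite elt ler_pM2r ?invr_gt0// r_le.
have m_r : m - 2 / d%:R <= r / d%:R.
  rewrite lerBlDr -mulrDl ler_pdivlMr//; apply: r_ge => t t0.
  rewrite -ler_pdivlMr//; apply: ge_inf.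
    exists (r / d%:R) => _ /= [s s0 <-]; rewrite elt ler_pM2r ?invr_gt0//.
    exact: r_le.
  by exists t => //; rewrite elt.
have abar0 : 0 < abar.
  apply: lt_bigmin => // i _; rewrite /alpha divr_gt0// ltr0n card_gt0.
    by rewrite finset.setIC.
  by apply: contraNneq (hST i) => ->; rewrite finset.set0I.
have abar1 : abar <= 1 by exact: bigmin_le_id.
have deltaE : (delta * (d%:R^-1)%:E = (r / d%:R)%:E)%E by rewrite /delta rE EFinM.
(* both errors in the statement are at least [2 / d] *)
rewrite deltaE !lee_fin r_m !andbT; split; apply: le_trans m_r.
  rewrite lerD2l lerN2; apply: ler_peMr; first by rewrite divr_ge0// ltW.
  by rewrite -[leLHS]sqrtr1; apply: ler_wsqrtr; rewrite mul1r invf_ge1.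
rewrite lerD2l lerN2 ler_wpM2l// lef_pV2 ?posrE ?sqrtr_gt0//.
have d1 : 1 <= Num.sqrt d%:R :> R by rewrite -[leLHS]sqrtr1 ler_wsqrtr// ler1n.
by rewrite -{2}(sqr_sqrtr (ltW d0)) expr2 ler_peMr// sqrtr_ge0.
Qed.
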